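(* Assume (A2), (A3) and $\rho<0$, and let $\alpha$ be the tail-index. (i) If $\alpha\le1$, then for every $p\in(0,\alpha)$ we have $h(p)<1$ and for all $k\ge1$ $$\mathbb{E}\|x_k\|^p\le (h(p))^k\,\mathbb{E}\|x_0\|^p+\frac{1-(h(p))^k}{1-h(p)}\,\mathbb{E}\|q_1\|^p.$$ (ii) If $\alpha>1$, then for every $p\in(1,\alpha)$ we have $h(p)<1$, and for every $0<\epsilon<\frac{1}{h(p)}-1$ and all $k\ge1$ $$\mathbb{E}\|x_k\|^p\le ((1+\epsilon)h(p))^k\,\mathbb{E}\|x_0\|^p+\frac{1-((1+\epsilon)h(p))^k}{1-(1+\epsilon)h(p)}\cdot\frac{(1+\epsilon)^{\frac{p}{p-1}}-(1+\epsilon)}{\left((1+\epsilon)^{\frac{1}{p-1}}-1\right)^p}\,\mathbb{E}\|q_1\|^p.$$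
   Context: Setup: integers $d,b\ge1$, stepsize $\eta>0$, i.i.d. data $(a_i,y_i)$; $H_k=\sum_{i=b(k-1)+1}^{bk}a_ia_i^T$, $M_k=I_d-\frac{\eta}{b}H_k$, $q_k=\frac{\eta}{b}\sum_{i=b(k-1)+1}^{bk}a_iy_i$, $x_k=M_kx_{k-1}+q_k$ with $x_0$ independent of the data. $\|\cdot\|$ Euclidean/spectral norm. $\Pi_k=M_k\cdots M_1$, $h(s)=\lim_{k\to\infty}(\mathbb{E}\|\Pi_k\|^s)^{1/k}$, $\rho=\lim_{k\to\infty}(2k)^{-1}\log\lambda_{\max}(\Pi_k^T\Pi_k)$. The tail-index $\alpha$ is the unique $\alpha>0$ with $h(\alpha)=1$. Assumptions: (A2) $y_i$ i.i.d. with continuous density supported on $\mathbb{R}$, all moments finite. (A3) $a_i\sim\mathcal{N}(0,\sigma^2I_d)$ i.i.d. *)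

(* Defs.v *)
From HB Require Import structures.
From mathcomp Require Import all_boot all_order all_algebra.
From mathcomp Require Import all_classical all_reals all_analysis.
Set Implicit Arguments.
Unset Strict Implicit.
Unset Printing Implicit Defensive.
Import Order.TTheory GRing.Theory Num.Theory.
Import numFieldNormedType.Exports.
Local Open Scope classical_set_scope.
Local Open Scope ring_scope.

Section defs.
Context {R : realType}.

Definition vnorm {n : nat} (v : 'cV[R]_n) : R :=
  Num.sqrt (\sum_(j < n) v j ord0 ^+ 2).

Definition opnorm {m n : nat} (M : 'M[R]_(m, n)) : R :=
  sup [set vnorm (M *m v) | v in [set v : 'cV[R]_n | vnorm v <= 1]].

Definition lambda_max {n : nat} (S : 'M[R]_n) : R :=
  sup [set a : R | eigenvalue S a].

(* Data are 0-indexed: a i, y i (i : nat) stand for the paper's a_{i+1}, y_{i+1}. *)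
Definition Hmat {T : Type} {n : nat} (b : nat) (a : nat -> T -> 'cV[R]_n)
    (k : nat) (w : T) : 'M[R]_n :=
  \sum_(b * (k - 1) <= i < b * k) (a i w *m (a i w)^T).

Definition Mmat {T : Type} {n : nat} (eta : R) (b : nat)
    (a : nat -> T -> 'cV[R]_n) (k : nat) (w : T) : 'M[R]_n :=
  1%:M - (eta / b%:R) *: Hmat b a k w.

Definition qvec {T : Type} {n : nat} (eta : R) (b : nat)
    (a : nat -> T -> 'cV[R]_n) (y : nat -> T -> R) (k : nat) (w : T)
    : 'cV[R]_n :=
  (eta / b%:R) *: \sum_(b * (k - 1) <= i < b * k) (y i w *: a i w).

Fixpoint xiter {T : Type} {n : nat} (eta : R) (b : nat)
    (a : nat -> T -> 'cV[R]_n) (y : nat -> T -> R) (x0 : T -> 'cV[R]_n)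
    (k : nat) (w : T) : 'cV[R]_n :=
  match k with
  | 0 => x0 w
  | k'.+1 => Mmat eta b a k'.+1 w *m xiter eta b a y x0 k' w
             + qvec eta b a y k'.+1 w
  end.

Fixpoint Pimat {T : Type} {n : nat} (eta : R) (b : nat)
    (a : nat -> T -> 'cV[R]_n) (k : nat) (w : T) : 'M[R]_n :=
  match k with
  | 0 => 1%:M
  | k'.+1 => Mmat eta b a k'.+1 w *m Pimat eta b a k' w
  end.

Section prob.
Context {dT : measure_display} {Omega : measurableType dT}
  (P : probability Omega R).

Definition hfun {n : nat} (eta : R) (b : nat) (a : nat -> Omega -> 'cV[R]_n)
    (s : R) : R :=
  lim ((fun k : nat =>
          (fine ('E_P[fun w => (opnorm (Pimat eta b a k w) `^ s)%R])%E)
            `^ (k%:R^-1)) @ \oo).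

(* Events of "rectangle" form generated by a random vector v:
   {v_1 in B_1} /\ ... /\ {v_n in B_n}, B_j Borel. They form a pi-system
   generating sigma(v). *)
Definition vec_events {n : nat} (v : Omega -> 'cV[R]_n) : set (set Omega) :=
  [set A | exists B : 'I_n -> set R, (forall j, measurable (B j)) /\
     A = \bigcap_(j in [set: 'I_n]) ((fun w => v w j ord0) @^-1` B j)].

Definition pair_event {n : nat} (a : Omega -> 'cV[R]_n) (y : Omega -> R)
    (B : 'I_n -> set R) (C : set R) : set Omega :=
  \bigcap_(j in [set: 'I_n]) ((fun w => a w j ord0) @^-1` B j) `&` (y @^-1` C).

Definition pair_events {n : nat} (a : Omega -> 'cV[R]_n) (y : Omega -> R)
    : set (set Omega) :=
  [set A | exists (B : 'I_n -> set R) (C : set R),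
     (forall j, measurable (B j)) /\ measurable C /\ A = pair_event a y B C].

Definition indep_systems {I : eqType} (G : I -> set (set Omega)) : Prop :=
  forall (s : seq I), uniq s -> forall A : I -> set Omega,
    (forall i, i \in s -> G i (A i)) ->
    P (\bigcap_(i in [set` s]) A i) = (\big[*%E/1%E]_(i <- s) P (A i))%E.

End prob.
End defs.

(* Main.v *)
(** Fix a unit vector [e] and write [m s] for the expectation of [|M_1 e|^s]. A
    standard Gaussian vector is invariant under rotations, so the expectation of
    [|M_k z|^s] is [m s * |z|^s] for every vector [z], hence [m s] times the
    expectation of [|Z|^s] when [Z] is random but independent of [M_k].
    Applied to [Z = Pi_(k-1) e_j] this gives [E |Pi_k e_j|^s = m s ^ k], and
    comparing the operator norm with its columns yields [h s = m s]. Young's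
    inequality [x^p <= (p/alpha) x^alpha + (1 - p/alpha)] bounds [m p] by 1, and
    the uniqueness of [alpha] excludes [m p = 1]. Applied to [Z = x_(k-1)], the
    same identity turns an inequality [(u + v)^p <= L u^p + K v^p] into the
    linear recursion [E |x_k|^p <= L (h p) E |x_(k-1)|^p + K E |q_1|^p].

    Rotations act on two coordinates at a time, where invariance of the
    Gaussian law follows by writing the rotation as three shears, each of which
    preserves Lebesgue measure. *)
Require Import Defs.
From HB Require Import structures.
From mathcomp Require Import all_boot all_order all_algebra.
From mathcomp Require Import all_classical all_reals all_analysis.
From mathcomp Require Import measurable_realfun ring.
Import Order.TTheory GRing.Theory Num.Theory.
Import numFieldNormedType.Exports.
Local Open Scope classical_set_scope.
Local Open Scope ring_scope.

Set Implicit Arguments.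
Unset Strict Implicit.
Unset Printing Implicit Defensive.

(** * Rotation invariance of the planar Gaussian law *)

(** The integral of a nonnegative function is a supremum over the simple functions below it, so
    monotonicity holds for non-measurable functions too. It is applied to powers of [opnorm]. *)
Lemma ge0_le_integral_nomeas (R : realType) d (T : measurableType d)
    (mu : {measure set T -> \bar R}) (f g : T -> \bar R) :
  (forall x, (0 <= f x)%E) -> (forall x, (f x <= g x)%E) ->
  (\int[mu]_x f x <= \int[mu]_x g x)%E.
Proof.
move=> f0 fg; rewrite !ge0_integralTE//; last by move=> x; exact: le_trans (fg x).
by apply: le_ereal_sup => _ [h hf <-]; exists h => //= x; exact: le_trans (fg x).
Qed.

(** Lebesgue measure is determined by its values on half-open intervals, and the preimage of such an
    interval is one of the same length. *)
Lemma lebesgue_measure_shift (R : realType) (c : R) (A : set R) : measurable A ->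
  pushforward lebesgue_measure ((fun x => x + c) : _ -> measurableTypeR R) A =
  lebesgue_measure A.
Proof.
move=> mA; apply/esym/lebesgue_measure_unique => //=.
  exact: measurable_funD.
move=> _ _ [[a b]] _ <-.
rewrite /pushforward (_ : _ @^-1` _ = `]a - c, b - c]%classic); last first.
  by apply/seteqP; split => x /=; rewrite !in_itv/= ltrBlDr lerBrDr.
by rewrite !lebesgue_measure_itv/= !lte_fin ltrD2 -!EFinB opprB addrA subrK.
Qed.

Lemma ge0_integral_shift (R : realType) (c : R) (f : R -> \bar R) :
  measurable_fun [set: measurableTypeR R] f -> (forall r, (0 <= f r)%E) ->
  (\int[lebesgue_measure]_x f (x + c)%R = \int[lebesgue_measure]_x f x)%E.
Proof.
move=> mf f0.
have mc : measurable_fun [set: measurableTypeR R] ((fun x => x + c) : _ -> measurableTypeR R).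
  exact: measurable_funD.
have := @ge0_integral_pushforward _ _ _ _ _ _ mc lebesgue_measure setT f
  measurableT mf (fun y _ => f0 y).
rewrite preimage_setT => /= <-.
by apply: eq_measure_integral => //= A mA _; exact: lebesgue_measure_shift.
Qed.

(** The Gaussian law is dominated by Lebesgue measure. Its Radon-Nikodym derivative and [normal_pdf]
    have the same integral over every measurable set, so they agree almost everywhere. *)
Lemma ge0_integral_normal_prob (R : realType) (m s : R) (f : R -> \bar R) : s != 0 ->
  measurable_fun [set: measurableTypeR R] f -> (forall r, (0 <= f r)%E) ->
  (\int[normal_prob m s]_x f x =
   \int[lebesgue_measure]_x (f x * (normal_pdf m s x)%:E))%E.
Proof.
move=> s0 mf f0.
have dom := normal_prob_dominates m s.
have mpdf : measurable_fun [set: measurableTypeR R] (fun x => (normal_pdf m s x)%:E).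
  by apply/measurable_EFinP; exact: measurable_normal_pdf.
rewrite -(Radon_Nikodym_SigmaFinite.change_of_variables dom)//.
apply: ae_eq_integral => //.
- apply: emeasurable_funM => //.
  exact: measurable_int (Radon_Nikodym_SigmaFinite.f_integrable dom).
- exact: emeasurable_funM.
- apply: ae_eqe_mul2l => /=.
  apply: integral_ae_eq => //=.
  + exact: Radon_Nikodym_SigmaFinite.f_integrable.
  + by move=> E _ mE; rewrite -Radon_Nikodym_SigmaFinite.f_integral.
Qed.

Section gauss2.
Context (R : realType).
Local Notation RR := (measurableTypeR R).
Local Notation L := (@lebesgue_measure R).

(** By Tonelli the first coordinate is integrated first; with the second one fixed, the shear is a
    translation. *)
Lemma ge0_integral_shear1 (t : R) (F : RR * RR -> \bar R) :
  measurable_fun setT F -> (forall z, (0 <= F z)%E) ->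
  (\int[L \x L]_z F (z.1 + t * z.2, z.2)%R = \int[L \x L]_z F z)%E.
Proof.
move=> mF F0.
have mS : measurable_fun [set: RR * RR]
    (fun z : RR * RR => ((z.1 + t * z.2)%R, z.2) : RR * RR).
  apply: measurable_fun_pair => //=.
  by apply: measurable_funD => //; exact: measurable_funM.
rewrite (fubini_tonelli2 _ (measurableT_comp mF mS) (fun=> F0 _)).
rewrite (fubini_tonelli2 F mF F0).
apply: eq_integral => y _; rewrite /fubini_G /=.
apply: (@ge0_integral_shift _ (t * y) (fun x => F (x, y))) => //.
exact: measurableT_comp.
Qed.

Lemma ge0_integral_shear2 (t : R) (F : RR * RR -> \bar R) :
  measurable_fun setT F -> (forall z, (0 <= F z)%E) ->
  (\int[L \x L]_z F (z.1, z.2 + t * z.1)%R = \int[L \x L]_z F z)%E.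
Proof.
move=> mF F0.
have mS : measurable_fun [set: RR * RR]
    (fun z : RR * RR => (z.1, (z.2 + t * z.1)%R) : RR * RR).
  apply: measurable_fun_pair => //=.
  by apply: measurable_funD => //; exact: measurable_funM.
rewrite (fubini_tonelli1 _ (measurableT_comp mF mS) (fun=> F0 _)).
rewrite (fubini_tonelli1 F mF F0).
apply: eq_integral => x _; rewrite /fubini_F /=.
apply: (@ge0_integral_shift _ (t * x) (fun y => F (x, y))) => //.
exact: measurableT_comp.
Qed.

Definition rot2 (c s : R) (z : RR * RR) : RR * RR :=
  (c * z.1 - s * z.2, s * z.1 + c * z.2).

Lemma measurable_rot2 c s : measurable_fun setT (rot2 c s).
Proof.
apply: measurable_fun_pair => /=.
  by apply: measurable_funB; exact: measurable_funM.
by apply: measurable_funD; exact: measurable_funM.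
Qed.

(** For the angle theta with cosine [c] and sine [s], [t] is tan(theta/2), which exists because
    [c != - 1]. The rotation is the composite of the shears with parameters [- t], [s], [- t]. *)
Lemma ge0_integral_rot2 (c s : R) (F : RR * RR -> \bar R) :
  c ^+ 2 + s ^+ 2 = 1 -> c != - 1 ->
  measurable_fun setT F -> (forall z, (0 <= F z)%E) ->
  (\int[L \x L]_z F (rot2 c s z) = \int[L \x L]_z F z)%E.
Proof.
move=> cs c1 mF F0; pose t := s / (1 + c).
have c1' : 1 + c != 0 by rewrite addrC addr_eq0.
have ts : t * s = 1 - c.
  have -> : t * s = s ^+ 2 / (1 + c) by rewrite /t mulrAC expr2.
  by rewrite -[s ^+ 2](addKr (c ^+ 2)) cs; field.
have tc : t * (1 + c) = s by rewrite /t mulfVK.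
pose S1 (z : RR * RR) : RR * RR := (z.1 + (- t) * z.2, z.2).
pose S2 (z : RR * RR) : RR * RR := (z.1, z.2 + s * z.1).
have mS1 : measurable_fun setT S1.
  apply: measurable_fun_pair => //=.
  by apply: measurable_funD => //; exact: measurable_funM.
have mS2 : measurable_fun setT S2.
  apply: measurable_fun_pair => //=.
  by apply: measurable_funD => //; exact: measurable_funM.
have SE z : rot2 c s z = S1 (S2 (S1 z)).
  rewrite /S1 /S2 /rot2 /=; congr pair.
    have -> : z.1 + - t * z.2 + - t * (z.2 + s * (z.1 + - t * z.2)) =
       (1 - t * s) * z.1 - (t * (1 + (1 - t * s))) * z.2 by ring.
    by rewrite ts subKr tc.
  have -> : z.2 + s * (z.1 + - t * z.2) = s * z.1 + (1 - t * s) * z.2 by ring.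
  by rewrite ts subKr.
under eq_integral do rewrite SE.
have mF1 := measurableT_comp mF mS1.
have mF2 := measurableT_comp mF1 mS2.
rewrite (ge0_integral_shear1 (- t) mF2 (fun=> F0 _)).
rewrite (ge0_integral_shear2 s mF1 (fun=> F0 _)).
by rewrite (ge0_integral_shear1 (- t) mF).
Qed.

Variable sigma : R.
Hypothesis sigma0 : sigma != 0.
Local Notation G := (normal_prob 0 sigma : probability RR R).

Lemma normal_prod_measureE (D : set (RR * RR)) : measurable D ->
  ((G \x G) D = \int[L \x L]_z
     (\1_D z * (normal_pdf 0 sigma z.1 * normal_pdf 0 sigma z.2))%:E)%E.
Proof.
move=> mD.
have m1 : measurable_fun setT (fun z => (\1_D z)%:E : \bar R).
  by apply/measurable_EFinP; exact: measurable_indic.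
have mp : measurable_fun [set: RR] (normal_pdf 0 sigma) by exact: measurable_normal_pdf.
have p0 x : 0 <= normal_pdf 0 sigma x by exact: normal_pdf_ge0.
rewrite -[D in LHS]setIT -integral_indic//.
rewrite fubini_tonelli1//.
rewrite ge0_integral_normal_prob//; last 2 first.
- exact: measurable_fun_fubini_tonelli_F.
- by move=> x; apply: integral_ge0 => y _; rewrite lee_fin.
rewrite fubini_tonelli1//=; last 2 first.
- apply/measurable_EFinP; apply: measurable_funM => //.
  exact: measurable_funM (measurableT_comp mp measurable_fst)
    (measurableT_comp mp measurable_snd).
- by move=> z; rewrite lee_fin !mulr_ge0.
apply: eq_integral => x _; rewrite /fubini_F.
have m1x : measurable_fun [set: RR] (fun y => (\1_D (x, y))%:E : \bar R).
  exact: measurable_fun_pair2 m1.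
rewrite ge0_integral_normal_prob//.
rewrite -ge0_integralZr ?lee_fin//; last 2 first.
- by apply: emeasurable_funM => //; exact/measurable_EFinP.
- by move=> y _; rewrite mule_ge0 ?lee_fin.
by apply: eq_integral => y _ /=; rewrite -!EFinM; congr EFin; ring.
Qed.

(** The product density depends only on the sum of the squares of the coordinates, which the
    rotation keeps, and Lebesgue measure is invariant by [ge0_integral_rot2]. *)
Lemma normal_prod_measure_rot2 (c s : R) (D : set (RR * RR)) :
  c ^+ 2 + s ^+ 2 = 1 -> c != - 1 -> measurable D ->
  ((G \x G) (rot2 c s @^-1` D) = (G \x G) D)%E.
Proof.
move=> cs c1 mD.
have mrD : measurable (rot2 c s @^-1` D).
  by rewrite -[X in measurable X]setTI; exact: measurable_rot2.
pose F (z : RR * RR) :=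
  (\1_D z * (normal_pdf 0 sigma z.1 * normal_pdf 0 sigma z.2))%:E.
have mF : measurable_fun setT F.
  apply/measurable_EFinP; apply: measurable_funM.
    exact: measurable_indic.
  have mp : measurable_fun [set: RR] (normal_pdf 0 sigma).
    exact: measurable_normal_pdf.
  exact: measurable_funM (measurableT_comp mp measurable_fst)
    (measurableT_comp mp measurable_snd).
have F0 z : (0 <= F z)%E by rewrite lee_fin !mulr_ge0// normal_pdf_ge0.
rewrite normal_prod_measureE// normal_prod_measureE//.
transitivity (\int[L \x L]_z F (rot2 c s z))%E; last exact: ge0_integral_rot2.
apply: eq_integral => z _; congr (_ * _)%:E.
rewrite /normal_pdf (negbTE sigma0) /normal_fun mulrACA -expRD [RHS]mulrACA -expRD.
congr (_ * expR _); rewrite -!mulrDl; congr (_ / _).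
rewrite /rot2 /= !subr0 -!opprD; congr (- _).
have -> : (c * z.1 - s * z.2) ^+ 2 + (s * z.1 + c * z.2) ^+ 2 =
  (c ^+ 2 + s ^+ 2) * (z.1 ^+ 2 + z.2 ^+ 2) by ring.
by rewrite cs mul1r.
Qed.

End gauss2.

(** * Gaussian families *)

Section family.
Context (R : realType) (I : finType).
Local Notation RR := (measurableTypeR R).

(** A pi-system of boxes generating the product sigma-algebra on [I -> R]; laws of families are
    compared on it. *)
Definition cylinders : set (set (I -> R)) :=
  [set A | exists B : I -> set R, (forall i, measurable (B i)) /\
     A = \bigcap_(i in [set: I]) ((fun f => f i) @^-1` B i)].

Local Notation cyl_space := (g_sigma_algebraType cylinders).

Lemma measurable_cyl_coord i : measurable_fun setT (fun f : cyl_space => f i).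
Proof.
move=> _ B mB; rewrite setTI; apply: sub_sigma_algebra.
exists (fun k => if k == i then B else setT); split.
  by move=> k; case: ifP.
apply/seteqP; split => [f Bf k _ /=|f /(_ i Logic.I)/=]; last by rewrite eqxx.
by case: eqP => // ->.
Qed.

Lemma bigcap_preimage_measurable d (T : measurableType d) (xi : I -> T -> R)
    (K : set I) (B : I -> set R) :
  (forall i, measurable_fun setT (xi i)) -> (forall i, measurable (B i)) ->
  measurable (\bigcap_(i in K) (xi i @^-1` B i)).
Proof.
move=> mxi mB; apply: fin_bigcap_measurable => [|i _]; first exact: finite_finset.
by rewrite -[X in measurable X]setTI; exact: mxi.
Qed.

Lemma measurable_to_cyl d (T : measurableType d) (xi : I -> T -> R) :
  (forall i, measurable_fun setT (xi i)) ->
  measurable_fun setT (fun w => (fun i => xi i w) : cyl_space).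
Proof.
move=> mxi; pose X : T -> cyl_space := fun w i => xi i w.
suff : measurable_fun setT X by [].
have := @measurability _ _ T cyl_space setT X cylinders erefl.
apply => _ [_ [B [mB ->]] <-].
rewrite setTI; exact: (@bigcap_preimage_measurable _ _ xi).
Qed.

Lemma setI_closed_cylinders : setI_closed cylinders.
Proof.
move=> _ _ [B [mB ->]] [C [mC ->]]; exists (fun i => B i `&` C i); split.
  by move=> i; exact: measurableI.
by rewrite -bigcapI; apply: eq_bigcapr => i _; rewrite preimage_setI.
Qed.

Lemma cylinders_setT : cylinders setT.
Proof. by exists (fun=> setT); split => //; apply/seteqP; split. Qed.

(** Both integrals are taken against pushforwards of [P] on [I -> R]. These are finite measures that
    agree on the pi-system of boxes, hence everywhere. *)
Lemma eq_law_integral d (T : measurableType d) (P : probability T R)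
    (xi xi' : I -> T -> R) (F : cyl_space -> \bar R) :
  (forall i, measurable_fun setT (xi i)) ->
  (forall i, measurable_fun setT (xi' i)) ->
  (forall B : I -> set R, (forall i, measurable (B i)) ->
    P (\bigcap_(i in [set: I]) (xi i @^-1` B i)) =
    P (\bigcap_(i in [set: I]) (xi' i @^-1` B i))) ->
  measurable_fun setT F -> (forall f, (0 <= F f)%E) ->
  (\int[P]_w F (fun i => xi i w) = \int[P]_w F (fun i => xi' i w))%E.
Proof.
move=> mxi mxi' E mF F0.
have mX := measurable_to_cyl mxi; have mX' := measurable_to_cyl mxi'.
have := @ge0_integral_pushforward _ _ _ _ _ _ mX P setT F measurableT mF (fun y _ => F0 y).
rewrite preimage_setT => /= <-.
have := @ge0_integral_pushforward _ _ _ _ _ _ mX' P setT F measurableT mF (fun y _ => F0 y).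
rewrite preimage_setT => /= <-.
apply: eq_measure_integral => //= A mA _.
pose m1 : {measure set cyl_space -> \bar R} :=
  pushforward P (fun w => (fun i => xi i w) : cyl_space).
pose m2 : {measure set cyl_space -> \bar R} :=
  pushforward P (fun w => (fun i => xi' i w) : cyl_space).
have := @measure_unique _ _ cyl_space cylinders (fun=> setT) erefl setI_closed_cylinders
  _ _ (m1 mX) (m2 mX').
apply => //=.
- by move=> _; exact: cylinders_setT.
- by rewrite bigcup_const.
- by move=> _ [B [mB ->]]; exact: E.
- by move=> _; rewrite /pushforward preimage_setT probability_setT ltry.
Qed.

Section gaussian.
Context d (T : measurableType d) (P : probability T R) (sigma : R).
Hypothesis sigma0 : sigma != 0.
Local Notation G := (normal_prob 0 sigma : probability RR R).

(** The product formula over all of [I] encodes independence as well, since any [B i] may be the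
    whole line. *)
Definition gaussian_family (xi : I -> T -> R) :=
  (forall i, measurable_fun setT (xi i)) /\
  forall B : I -> set R, (forall i, measurable (B i)) ->
    P (\bigcap_(i in [set: I]) (xi i @^-1` B i)) =
    (\prod_(i : I) normal_prob 0 sigma (B i))%E.

Definition rotfam (i j : I) (c s : R) (xi : I -> T -> R) (k : I) (w : T) : R :=
  if k == i then c * xi i w - s * xi j w
  else if k == j then s * xi i w + c * xi j w else xi k w.

(** The constraints on the coordinates other than [i] and [j] form an event [E]. On [E] the pair of
    the two rotated coordinates has a constant multiple of the planar Gaussian law, and that law is
    rotation invariant. *)
Lemma gaussian_family_rotfam i j c s xi : i != j ->
  c ^+ 2 + s ^+ 2 = 1 -> c != - 1 -> gaussian_family xi ->
  gaussian_family (rotfam i j c s xi).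
Proof.
move=> ij cs c1 [mxi gxi]; split=> [k|B mB].
  rewrite /rotfam; case: (eqVneq k i) => _; [|case: (eqVneq k j) => _ //].
    by apply: measurable_funB; exact: measurable_funM.
  by apply: measurable_funD; exact: measurable_funM.
have ji : (j == i) = false by rewrite eq_sym; exact/negbTE.
pose K := [set k : I | (k != i) && (k != j)].
pose E := \bigcap_(k in K) (xi k @^-1` B k).
have mE : measurable E by exact: bigcap_preimage_measurable.
pose pr (w : T) : RR * RR := (xi i w, xi j w).
have mpr : measurable_fun setT pr by apply: measurable_fun_pair; exact: mxi.
(* The law of the pair under [P] restricted to [E]; its total mass is [c0]. *)
pose nu0 : {measure set (RR * RR) -> \bar R} := pushforward (mrestr P mE) pr.
pose nu := nu0 mpr.
pose c0 : \bar R := (\prod_(k | (k != i) && (k != j)) G (B k))%E.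
have c0_ge0 : (0 <= c0)%E by apply: prode_ge0.
have c0_fin : c0 \is a fin_num.
  by apply: prode_fin_num => k _; apply: fin_num_measure; exact: mB.
pose c0' : {nonneg R} := NngNum (fine_ge0 c0_ge0).
have c0'E : (c0'%:num)%:E = c0 by rewrite /= fineK.
have split_prod (X Y : set R) :
    (\prod_k G (if k == i then X else if k == j then Y else B k) = c0 * G X * G Y)%E.
  rewrite (bigD1 i)//= eqxx (bigD1 j) ?ji//= eqxx.
  rewrite (eq_bigr (fun k => G (B k))); last first.
    by move=> k /andP[/negbTE -> /negbTE ->].
  by rewrite -/c0 muleA muleC muleA.
have nuE (X Y : set RR) : measurable X -> measurable Y ->
    nu (X `*` Y) = (c0 * G X * G Y)%E.
  move=> mX mY; rewrite -split_prod -gxi; last first.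
    by move=> k; case: ifP => // _; case: ifP.
  rewrite /nu /nu0 /pushforward /mrestr; congr (P _).
  apply/seteqP; split => [w [[/= Xw Yw] Ew] k _ /=|w Bw].
    by case: eqP => [->//|/eqP ki]; case: eqP => [->//|/eqP kj]; apply: Ew; rewrite /K /= ki.
  split; first by split => /=; [have := Bw i Logic.I|have := Bw j Logic.I];
    rewrite /= eqxx ?ji.
  by move=> k /andP[/negbTE ki /negbTE kj]; have := Bw k Logic.I; rewrite /= ki kj.
(* Uniqueness of product measures, used twice: [nu] and the scaled planar law both agree on
   rectangles with the product of the scaled [G] and [G]. *)
have nuD (D : set (RR * RR)) : measurable D -> nu D = (c0 * (G \x G) D)%E.
  move=> mD.
  rewrite -(@product_measure_unique _ _ _ _ _ (mscale c0' G) G)//; last first.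
    by move=> X Y mX mY; rewrite nuE//= /mscale c0'E.
  rewrite (@product_measure_unique _ _ _ _ _ (mscale c0' G) G (mscale c0' (G \x G)%E))//.
    by rewrite -c0'E.
  move=> X Y mX mY; transitivity (c0 * (G \x G) (X `*` Y))%E; first by rewrite -c0'E.
  by rewrite product_measure1E// muleA -c0'E.
have -> : \bigcap_(k in [set: I]) (rotfam i j c s xi k @^-1` B k) =
    (pr @^-1` (rot2 c s @^-1` (B i `*` B j))) `&` E.
  apply/seteqP; split => [w Bw|w [[/= Biw Bjw] Ew] k _].
    split; first by split => /=; [have := Bw i Logic.I|have := Bw j Logic.I];
      rewrite /rotfam /= eqxx ?ji.
    by move=> k /andP[/negbTE ki /negbTE kj]; have := Bw k Logic.I; rewrite /= /rotfam ki kj.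
  rewrite /rotfam /=; case: eqP => [->//|/eqP ki]; case: eqP => [->//|/eqP kj].
  by apply: Ew; rewrite /K /= ki.
have mBB : measurable (B i `*` B j : set (RR * RR)) by apply: measurableX; exact: mB.
transitivity (nu (rot2 c s @^-1` (B i `*` B j))) => //.
rewrite nuD; last first.
  by rewrite -[X in measurable X]setTI; exact: measurable_rot2.
rewrite normal_prod_measure_rot2//.
transitivity (c0 * (G (B i) * G (B j)))%E.
  by congr (_ * _)%E; apply: product_measure1E; exact: mB.
rewrite muleA -split_prod.
apply: eq_bigr => k _; case: eqP => [->//|_]; by case: eqP => [->//|_].
Qed.

End gaussian.
End family.

(** * Independence of generated sigma-algebras *)

Section independence.
Context (R : realType) (d : measure_display) (T : measurableType d)
  (P : probability T R).

Section two_systems.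
Variables C1 C2 : set (set T).
Hypotheses (mC1 : C1 `<=` measurable) (mC2 : C2 `<=` measurable).
Hypotheses (C1I : setI_closed C1) (C2I : setI_closed C2).
Hypotheses (C1T : C1 setT) (C2T : C2 setT).
Hypothesis C12 : forall A B, C1 A -> C2 B -> P (A `&` B) = (P A * P B)%E.

Lemma g_sigma_sub (C : set (set T)) A :
  C `<=` measurable -> <<s C >> A -> measurable A.
Proof. by move=> mC; apply: (smallest_sub (@sigma_algebra_measurable _ T)). Qed.

(** In [A], both sides are finite measures, a restriction and a rescaling of [P]; agreement on a
    pi-system extends to the sigma-algebra it generates. *)
Lemma indep_extend (C : set (set T)) (B : set T) :
  C `<=` measurable -> setI_closed C -> C setT -> measurable B ->
  (forall A, C A -> P (A `&` B) = (P A * P B)%E) ->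
  forall A, <<s C >> A -> P (A `&` B) = (P A * P B)%E.
Proof.
move=> mC CI CT mB CB A sA.
have PBfin : P B \is a fin_num by exact: fin_num_measure.
pose r : {nonneg R} := NngNum (fine_ge0 (measure_ge0 P B)).
have rE : (r%:num)%:E = P B by rewrite /= fineK.
suff : mrestr P mB A = mscale r P A.
  by rewrite /mrestr /mscale => ->; rewrite rE muleC.
apply: (@g_sigma_algebra_measure_unique _ _ T C mC (fun=> setT)) => //.
- by rewrite bigcup_const.
- by move=> X CX; rewrite /= /mscale rE muleC; exact: CB.
- move=> _ /=; rewrite /mrestr setTI.
  by rewrite (le_lt_trans (probability_le1 P mB))// ltry.
Qed.

Lemma indep_g_sigma A B : <<s C1 >> A -> <<s C2 >> B ->
  P (A `&` B) = (P A * P B)%E.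
Proof.
move=> sA sB; apply: (indep_extend mC1) => //; first exact: g_sigma_sub sB.
move=> X CX; rewrite setIC muleC; apply: (indep_extend mC2) => //.
  exact: mC1.
by move=> Y CY; rewrite setIC muleC; exact: C12.
Qed.

(** Under independence the diagonal map sends [P] to the product of its restrictions to the two
    sigma-algebras, and Tonelli then separates the variables. This allows one argument to be frozen
    while the other is averaged. *)
Lemma ge0_integral_indep
    (f : g_sigma_algebraType C1 * g_sigma_algebraType C2 -> \bar R) :
  measurable_fun setT f -> (forall z, (0 <= f z)%E) ->
  (\int[P]_w f (w, w) = \int[P]_w \int[P]_w' f (w, w'))%E.
Proof.
move=> mf f0.
have m1 : measurable_fun setT (idfun : T -> g_sigma_algebraType C1).
  by move=> _ A; rewrite setTI; exact: g_sigma_sub.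
have m2 : measurable_fun setT (idfun : T -> g_sigma_algebraType C2).
  by move=> _ A; rewrite setTI; exact: g_sigma_sub.
(* The identity, seen as a random variable into a coarser sigma-algebra, has as its distribution the
   restriction of [P]. *)
pose X1 : {mfun T >-> g_sigma_algebraType C1} :=
  HB.pack (idfun : T -> g_sigma_algebraType C1) (isMeasurableFun.Build _ _ _ _ _ m1).
pose X2 : {mfun T >-> g_sigma_algebraType C2} :=
  HB.pack (idfun : T -> g_sigma_algebraType C2) (isMeasurableFun.Build _ _ _ _ _ m2).
pose D (w : T) : g_sigma_algebraType C1 * g_sigma_algebraType C2 := (w, w).
have mD : measurable_fun setT D by exact: measurable_fun_pair.
pose nu0 : {measure set (g_sigma_algebraType C1 * g_sigma_algebraType C2) -> \bar R} :=
  pushforward P D.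
have := @ge0_integral_pushforward _ _ _ _ _ _ mD P setT f measurableT mf (fun y _ => f0 y).
rewrite preimage_setT => /= <-.
transitivity (\int[distribution P X1 \x distribution P X2]_z f z)%E.
  apply: (@eq_measure_integral _ _ _ _ _ (nu0 mD)) => A mA _.
  apply/esym; apply: (@product_measure_unique _ _ _ _ _
    (distribution P X1) (distribution P X2) (nu0 mD)) => //.
  by move=> X Y mX mY; exact: indep_g_sigma.
rewrite fubini_tonelli1//.
have mF := measurable_fun_fubini_tonelli_F (m2 := distribution P X2) f mf f0.
have F0 z : (0 <= fubini_F (distribution P X2) f z)%E.
  by apply: integral_ge0 => y _.
have := @ge0_integral_pushforward _ _ _ _ _ _ m1 P setT _ measurableT mF (fun y _ => F0 y).
rewrite preimage_setT => /= ->.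
apply: eq_integral => w _; rewrite /fubini_F /=.
have mfw : measurable_fun setT (fun y : g_sigma_algebraType C2 => f (w, y)).
  exact: (@measurable_fun_pair2 _ _ _ (g_sigma_algebraType C1) _ _ f w mf).
have := @ge0_integral_pushforward _ _ _ _ _ _ m2 P setT _ measurableT mfw (fun y _ => f0 _).
by rewrite preimage_setT => /= ->.
Qed.

End two_systems.

Section families.
Context (I : eqType) (G : I -> set (set T)).
Hypothesis GI : indep_systems P G.
Hypothesis mG : forall i, G i `<=` measurable.
Hypothesis GcI : forall i, setI_closed (G i).
Hypothesis GT : forall i, G i setT.

(** A pi-system for the sigma-algebra jointly generated by the systems with index in [s]. *)
Definition joint_system (s : seq I) : set (set T) :=
  [set X | exists A : I -> set T, (forall i, i \in s -> G i (A i)) /\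
     X = \bigcap_(i in [set` s]) A i].

Lemma joint_system_measurable s : joint_system s `<=` measurable.
Proof.
move=> _ [A [GA ->]]; apply: fin_bigcap_measurable => [|i si].
  exact: finite_seq.
by apply: (@mG i); exact: GA.
Qed.

Lemma setI_closed_joint_system s : setI_closed (joint_system s).
Proof.
move=> _ _ [A [GA ->]] [B [GB ->]]; exists (fun i => A i `&` B i); split.
  by move=> i si; apply: GcI; [exact: GA|exact: GB].
by rewrite bigcapI.
Qed.

Lemma joint_system_setT s : joint_system s setT.
Proof. by exists (fun=> setT); split => //; apply/seteqP; split. Qed.

Lemma sub_joint_system s i : i \in s -> G i `<=` joint_system s.
Proof.
move=> si A GA; exists (fun k => if k == i then A else setT); split.
  by move=> k _; case: eqP => // ->.
apply/seteqP; split => [w Aw k _ /=|w /(_ i si)/=]; last by rewrite eqxx.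
by case: eqP.
Qed.

Lemma indep_joint_system s1 s2 : uniq (s1 ++ s2) ->
  forall A B, joint_system s1 A -> joint_system s2 B -> P (A `&` B) = (P A * P B)%E.
Proof.
rewrite cat_uniq => /and3P[u1 s12 u2] _ _ [A [GA ->]] [B [GB ->]].
have s2N i : i \in s2 -> (i \in s1) = false.
  by move=> si; apply/negbTE; apply: contra s12 => ?; apply/hasP; exists i.
have u12 : uniq (s1 ++ s2) by rewrite cat_uniq u1 s12.
(* As the two lists are disjoint, one choice of events serves both. Independence is then used for
   the concatenation and for each list. *)
pose C i := if i \in s1 then A i else B i.
have := GI u12 (A := C).
have -> : \bigcap_(i in [set` s1 ++ s2]) C i =
    (\bigcap_(i in [set` s1]) A i) `&` (\bigcap_(i in [set` s2]) B i).
  apply/seteqP; split => [w Cw|w [Aw Bw] i /=].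
    split => i /= si; have := Cw i; rewrite /= mem_cat si ?orbT => /(_ isT).
      by rewrite /C si.
    by rewrite /C s2N.
  rewrite mem_cat /C; case: ifPn => [si _|_ /= si]; [exact: Aw|exact: Bw].
move=> ->; last first.
  by move=> i; rewrite mem_cat /C; case: ifPn => [si _|_ /= si]; [exact: GA|exact: GB].
rewrite big_cat/=; congr (_ * _)%E.
  rewrite (GI u1 GA) big_seq [RHS]big_seq; apply: eq_bigr => i si.
  by rewrite /C si.
rewrite (GI u2 GB) big_seq [RHS]big_seq; apply: eq_bigr => i si.
by rewrite /C s2N.
Qed.

End families.
End independence.

(** * Euclidean norms and powers *)

Section euclid.
Context (R : realType).

Lemma vnorm_ge0 n (v : 'cV[R]_n) : 0 <= vnorm v.
Proof. exact: sqrtr_ge0. Qed.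

Lemma sqr_vnorm n (v : 'cV[R]_n) : vnorm v ^+ 2 = \sum_(j < n) v j ord0 ^+ 2.
Proof. by rewrite sqr_sqrtr// sumr_ge0// => j _; rewrite sqr_ge0. Qed.

Lemma vnormE n (v : 'cV[R]_n) : vnorm v = Num.sqrt ((v^T *m v) ord0 ord0).
Proof. by rewrite mxE; congr Num.sqrt; apply: eq_bigr => j _; rewrite mxE. Qed.

Lemma vnormZ n (c : R) (v : 'cV[R]_n) : vnorm (c *: v) = `|c| * vnorm v.
Proof.
rewrite /vnorm -sqrtr_sqr -sqrtrM ?sqr_ge0// mulr_sumr.
by congr Num.sqrt; apply: eq_bigr => j _; rewrite mxE exprMn.
Qed.

Lemma ler_coord_vnorm n (v : 'cV[R]_n) j : `|v j ord0| <= vnorm v.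
Proof.
rewrite -sqrtr_sqr ler_sqrt ?sumr_ge0// => [|k _]; last by rewrite sqr_ge0.
by rewrite (bigD1 j)//= lerDl sumr_ge0// => k _; rewrite sqr_ge0.
Qed.

Lemma vnorm_eq0 n (v : 'cV[R]_n) : vnorm v = 0 -> v = 0.
Proof.
move=> v0; apply/colP => j; rewrite mxE; apply/eqP.
by rewrite -normr_le0 -v0 ler_coord_vnorm.
Qed.

Lemma vnorm0 n : vnorm (0 : 'cV[R]_n) = 0.
Proof. by rewrite -(scale0r (0 : 'cV_n)) vnormZ normr0 mul0r. Qed.

(** Cauchy-Schwarz: for nonzero vectors, expand the nonnegative squared norm of
    [vnorm v *: u - vnorm u *: v]. *)
Lemma dotr_le_vnorm n (u v : 'cV[R]_n) :
  \sum_(j < n) u j ord0 * v j ord0 <= vnorm u * vnorm v.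
Proof.
have [u0|u0] := eqVneq (vnorm u) 0.
  by rewrite u0 mul0r big1// => j _; rewrite (vnorm_eq0 u0) mxE mul0r.
have [v0|v0] := eqVneq (vnorm v) 0.
  by rewrite v0 mulr0 big1// => j _; rewrite (vnorm_eq0 v0) mxE mulr0.
have uv0 : 0 < vnorm u * vnorm v by rewrite mulr_gt0// lt0r vnorm_ge0 ?u0 ?v0.
have : 0 <= \sum_j (vnorm v * u j ord0 - vnorm u * v j ord0) ^+ 2.
  by apply: sumr_ge0 => j _; rewrite sqr_ge0.
have -> : \sum_j (vnorm v * u j ord0 - vnorm u * v j ord0) ^+ 2 =
   2 * (vnorm u * vnorm v) *
     (vnorm u * vnorm v - \sum_j (u j ord0 * v j ord0)).
  rewrite (eq_bigr (fun j => vnorm v ^+ 2 * u j ord0 ^+ 2 +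
    vnorm u ^+ 2 * v j ord0 ^+ 2 -
    2 * (vnorm u * vnorm v) * (u j ord0 * v j ord0))); last by move=> j _; ring.
  rewrite big_split big_split/= sumrN -!mulr_sumr -!sqr_vnorm; ring.
have uv2 : 0 < 2 * (vnorm u * vnorm v) by rewrite mulr_gt0.
by rewrite (pmulr_rge0 _ uv2) subr_ge0.
Qed.

Lemma ler_vnormD n (u v : 'cV[R]_n) : vnorm (u + v) <= vnorm u + vnorm v.
Proof.
rewrite -(@ler_pXn2r _ 2)// ?nnegrE ?addr_ge0 ?vnorm_ge0//.
rewrite sqr_vnorm sqrrD !sqr_vnorm.
under eq_bigr => j _ do rewrite mxE sqrrD.
rewrite !big_split/= lerD2r lerD2l mulr2n lerD//; exact: dotr_le_vnorm.
Qed.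

Lemma ler_vnorm_sum n (I : finType) (F : I -> 'cV[R]_n) :
  vnorm (\sum_i F i) <= \sum_i vnorm (F i).
Proof.
elim/big_ind2 : _ => [|x1 x2 y1 y2 h1 h2|//]; first by rewrite vnorm0.
by rewrite (le_trans (ler_vnormD _ _))// lerD.
Qed.

Lemma mulmx_col_sum m n (A : 'M[R]_(m, n)) (v : 'cV[R]_n) :
  A *m v = \sum_j v j ord0 *: (A *m delta_mx j ord0).
Proof.
by rewrite {1}[v]matrix_sum_delta mulmx_sumr; apply: eq_bigr => j _;
  rewrite big_ord1 scalemxAr.
Qed.

Lemma vnorm_mulmx_le m n (A : 'M[R]_(m, n)) (v : 'cV[R]_n) : vnorm v <= 1 ->
  vnorm (A *m v) <= \sum_j vnorm (A *m delta_mx j ord0).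
Proof.
move=> v1; rewrite mulmx_col_sum (le_trans (ler_vnorm_sum _))//.
apply: ler_sum => j _; rewrite vnormZ ler_piMl ?vnorm_ge0//.
exact: le_trans (ler_coord_vnorm _ _) v1.
Qed.

Lemma vnorm_delta n (j : 'I_n) : vnorm (delta_mx j ord0 : 'cV[R]_n) = 1.
Proof.
rewrite /vnorm (bigD1 j)//= mxE !eqxx big1 ?addr0 ?expr1n ?sqrtr1// => k kj.
by rewrite mxE (negbTE kj) expr0n.
Qed.

Lemma opnorm_le m n (A : 'M[R]_(m, n)) :
  opnorm A <= \sum_j vnorm (A *m delta_mx j ord0).
Proof.
apply: ge_sup.
  by exists (vnorm (A *m 0)), 0 => //=; rewrite vnorm0.
by move=> _ [v /= v1 <-]; exact: vnorm_mulmx_le.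
Qed.

(** A supremum in [R] dominates its set only if the set is bounded above; the sum of the column
    norms is such a bound. *)
Lemma vnorm_mulmx_opnorm m n (A : 'M[R]_(m, n)) (v : 'cV[R]_n) :
  vnorm v <= 1 -> vnorm (A *m v) <= opnorm A.
Proof.
move=> v1; apply: ub_le_sup; last by exists v.
exists (\sum_j vnorm (A *m delta_mx j ord0)) => _ [u /= u1 <-].
exact: vnorm_mulmx_le.
Qed.

Lemma opnorm_ge0 m n (A : 'M[R]_(m, n)) : 0 <= opnorm A.
Proof.
apply: (@le_trans _ _ (vnorm (A *m 0))); first exact: vnorm_ge0.
by rewrite vnorm_mulmx_opnorm// vnorm0.
Qed.

End euclid.

Section powers.
Context (R : realType).
Implicit Types (p s x y : R).

Lemma ler_powRl p x y : 0 <= p -> 0 <= x -> x <= y -> x `^ p <= y `^ p.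
Proof.
move=> p0 x0 xy; apply: ge0_ler_powR => //; rewrite nnegrE//.
exact: le_trans xy.
Qed.

(** The sum is at most [n] times its largest term, whose power is one of the summands on the right.
    This covers [s] below and above 1 alike. *)
Lemma powR_sum_le n s (u : 'I_n -> R) : 0 < s -> (forall j, 0 <= u j) ->
  (\sum_j u j) `^ s <= n%:R `^ s * \sum_j (u j) `^ s.
Proof.
move=> s0 u0; case: n u u0 => [|n] u u0.
  by rewrite !big_ord0 mulr0 powR0// gt_eqF.
have [j0 _ hj0] := @arg_maxP _ R 'I_n.+1 ord0 xpredT u isT.
have le1 : \sum_j u j <= n.+1%:R * u j0.
  rewrite mulr_natl -[X in _ *+ X]card_ord -sumr_const.
  by apply: ler_sum => j _; exact: hj0.
apply: (le_trans (ler_powRl (ltW s0) _ le1)); first exact: sumr_ge0.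
rewrite powRM// ler_wpM2l ?powR_ge0// (bigD1 j0)//= lerDl.
by apply: sumr_ge0 => j _; exact: powR_ge0.
Qed.

(** A ratio [r] in [0, 1] satisfies [r <= r ^ p]; apply this to [x / (x + y)] and [y / (x + y)] and
    add. *)
Lemma powRD_le p x y : 0 < p <= 1 -> 0 <= x -> 0 <= y ->
  (x + y) `^ p <= x `^ p + y `^ p.
Proof.
move=> /andP[p0 p1] x0 y0.
have [xy0|xy0] := eqVneq (x + y) 0.
  by rewrite xy0 powR0 ?gt_eqF// addr_ge0 ?powR_ge0.
have xyp : 0 < x + y by rewrite lt0r xy0 addr_ge0.
have key z : 0 <= z -> z <= x + y -> z / (x + y) * (x + y) `^ p <= z `^ p.
  move=> z0 zxy; have [->|zn0] := eqVneq z 0; first by rewrite !mul0r powR_ge0.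
  rewrite -[in leRHS](divfK xy0 z) powRM ?divr_ge0 ?(ltW xyp)// ler_wpM2r ?powR_ge0//.
  apply: ger1_powR => //; apply/andP; split; first by rewrite divr_gt0// lt0r zn0.
  by rewrite ler_pdivrMr// mul1r.
have := lerD (key x x0 _) (key y y0 _).
rewrite -!mulrDl divff// mul1r; apply; by rewrite ?lerDl ?lerDr.
Qed.

(* Convexity of [t |-> t ^ p] at the weights [t^-1] and [1 - t^-1], where
   [t = (1 + eps) ^ (1 / (p - 1))]. *)
Lemma powRD_le_eps p x y eps : 1 < p -> 0 <= x -> 0 <= y -> 0 < eps ->
  (x + y) `^ p <= (1 + eps) * x `^ p +
    ((1 + eps) `^ (p / (p - 1)) - (1 + eps)) /
      ((1 + eps) `^ ((p - 1)^-1) - 1) `^ p * y `^ p.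
Proof.
move=> p1 x0 y0 e0.
have p0 : 0 < p by exact: lt_trans p1.
have pm1 : 0 < p - 1 by rewrite subr_gt0.
have e1 : 0 < 1 + eps by rewrite addr_gt0.
set t := (1 + eps) `^ ((p - 1)^-1).
have t0 : 0 < t by rewrite powR_gt0.
(* This identity dictates [t]: convexity at the points [x * t] and [y / (1 - t^-1)] gives [x ^ p]
   the coefficient [t ^ p / t]. *)
have tp1 : t `^ (p - 1) = 1 + eps.
  by rewrite /t -powRrM mulVf ?gt_eqF// powRr1// ltW.
have t1 : 1 < t.
  rewrite ltNge; apply/negP => t1; have := ler_powRl (ltW pm1) (ltW t0) t1.
  by rewrite tp1 powR1 gerDl leNgt e0.
have tp : (1 + eps) `^ (p / (p - 1)) = t `^ p by rewrite mulrC powRrM.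
have tpE : t `^ p = t * (1 + eps) by rewrite -tp1 mulr_powRB1// ltW.
have l01 : 0 <= t^-1 <= 1 by rewrite invr_ge0 ltW//= invf_le1// ltW.
pose l := Itv01 (proj1 (andP l01)) (proj2 (andP l01)).
have u0 : 0 < 1 - t^-1 by rewrite subr_gt0 invf_lt1.
have hx : x * t \in (`[0, +oo[%classic : set R).
  by rewrite inE /= in_itv/= andbT mulr_ge0// ltW.
have hy : y / (1 - t^-1) \in (`[0, +oo[%classic : set R).
  by rewrite inE /= in_itv/= andbT divr_ge0// ltW.
have : (t^-1 * (x * t) + (1 - t^-1) * (y / (1 - t^-1))) `^ p <=
    t^-1 * (x * t) `^ p + (1 - t^-1) * (y / (1 - t^-1)) `^ p.
  exact: (@convex_powR R p (ltW p1) l _ _ hx hy).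
have -> : t^-1 * (x * t) + (1 - t^-1) * (y / (1 - t^-1)) = x + y.
  by rewrite mulrCA mulVf ?gt_eqF// mulr1 mulrCA divff ?gt_eqF// mulr1.
move=> /le_trans; apply; apply: lerD.
  rewrite powRM ?(ltW t0)// tpE [leLHS](_ : _ = (t^-1 * t) * (1 + eps) * x `^ p); last by ring.
  by rewrite mulVf ?gt_eqF// mul1r.
rewrite tp tpE powRM//; last by rewrite invr_ge0 ltW.
(* The two coefficients of [y ^ p] are in fact equal: both are
   [(t - 1) * (1 + eps) / (t - 1) ^ p]. *)
have -> : t * (1 + eps) - (1 + eps) = (t - 1) * (1 + eps) by ring.
have -> : (1 - t^-1) * (y `^ p * (1 - t^-1)^-1 `^ p) =
  (1 - t^-1) * (1 - t^-1)^-1 `^ p * y `^ p by ring.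
rewrite ler_wpM2r ?powR_ge0//.
have tm1 : 0 < t - 1 by rewrite subr_gt0.
have -> : 1 - t^-1 = (t - 1) / t by field; rewrite gt_eqF.
rewrite invf_div powRM ?invr_ge0 ?(ltW tm1) ?(ltW t0)// tpE.
have -> : (t - 1)^-1 `^ p = ((t - 1) `^ p)^-1.
  by rewrite -(powR_inv1 (ltW tm1)) -powRrM mulN1r powRN.
rewrite le_eqVlt; apply/orP; left; apply/eqP; field.
by rewrite gt_eqF ?powR_gt0//= gt_eqF.
Qed.

(** Young's inequality for the product of [x ^ p] and 1, with conjugate exponents [s / p] and
    [(1 - p / s)^-1]. *)
Lemma powR_young p s x : 0 < p -> p < s -> 0 <= x ->
  x `^ p <= p / s * x `^ s + (1 - p / s).
Proof.
move=> p0 ps x0; have s0 : 0 < s by exact: lt_trans ps.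
have ps0 : 0 < p / s by rewrite divr_gt0.
have ps1 : 0 < 1 - p / s by rewrite subr_gt0 ltr_pdivrMr// mul1r.
have := @conjugate_powR R (x `^ p) 1 (s / p) (1 - p / s)^-1 (powR_ge0 _ _) ler01
   (divr_gt0 s0 p0).
rewrite invr_gt0 ps1 => /(_ isT).
rewrite invrK invf_div addrC subrK => /(_ erefl).
have -> : (x `^ p) `^ (s / p) = x `^ s by rewrite -powRrM mulrC divfK ?gt_eqF.
by rewrite mulr1 powR1 mul1r mulrC.
Qed.

End powers.

(** * Measurability of matrix-valued maps *)

Section measurable_matrix.
Context (R : realType) (d : measure_display) (T : measurableType d).

(** The domain is arbitrary so that the closure lemmas also serve sigma-algebras generated by part
    of the data. *)
Definition mx_measurable m n (A : T -> 'M[R]_(m, n)) :=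
  forall i j, measurable_fun setT (fun w => A w i j).

Lemma mx_measurable_cst m n (A : 'M[R]_(m, n)) : mx_measurable (fun=> A).
Proof. by move=> i j; exact: measurable_cst. Qed.

Lemma mx_measurableD m n (A B : T -> 'M[R]_(m, n)) :
  mx_measurable A -> mx_measurable B -> mx_measurable (fun w => A w + B w).
Proof.
move=> mA mB i j; under eq_fun do rewrite mxE.
by apply: measurable_funD; [exact: mA|exact: mB].
Qed.

Lemma mx_measurableZ m n (c : T -> R) (A : T -> 'M[R]_(m, n)) :
  measurable_fun setT c -> mx_measurable A -> mx_measurable (fun w => c w *: A w).
Proof.
move=> mc mA i j; under eq_fun do rewrite mxE.
by apply: measurable_funM => //; exact: mA.
Qed.

Lemma mx_measurableN m n (A : T -> 'M[R]_(m, n)) :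
  mx_measurable A -> mx_measurable (fun w => - A w).
Proof.
move=> mA i j; under eq_fun do rewrite mxE.
by apply: measurable_funN; exact: mA.
Qed.

Lemma mx_measurableM m n k (A : T -> 'M[R]_(m, n)) (B : T -> 'M[R]_(n, k)) :
  mx_measurable A -> mx_measurable B -> mx_measurable (fun w => A w *m B w).
Proof.
move=> mA mB i j; under eq_fun do rewrite mxE.
apply: measurable_sum => l.
by apply: measurable_funM; [exact: mA|exact: mB].
Qed.

Lemma mx_measurable_sum m n (I : Type) (s : seq I) (A : I -> T -> 'M[R]_(m, n)) :
  (forall i, mx_measurable (A i)) -> mx_measurable (fun w => \sum_(i <- s) A i w).
Proof.
move=> mA i j; under eq_fun do rewrite summxE.
by apply: measurable_sum => l; exact: mA.
Qed.

Lemma mx_measurable_sum_nat m n (p q : nat) (A : nat -> T -> 'M[R]_(m, n)) :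
  (forall i, (p <= i < q)%N -> mx_measurable (A i)) ->
  mx_measurable (fun w => \sum_(p <= i < q) A i w).
Proof.
move=> mA.
(* Terms outside the range become 0, since a sigma-algebra that sees only the range need not make
   them measurable. *)
rewrite (_ : (fun w => _) = (fun w => \sum_(i <- index_iota p q)
    (if (p <= i < q)%N then A i w else 0))).
  apply: mx_measurable_sum => i; case: (boolP (p <= i < q)%N) => [|_];
    [exact: mA|exact: mx_measurable_cst].
by apply/funext => w; rewrite big_nat big_mkcond.
Qed.

Lemma mx_measurable_tr m n (A : T -> 'M[R]_(m, n)) :
  mx_measurable A -> mx_measurable (fun w => (A w)^T).
Proof. by move=> mA i j; under eq_fun do rewrite mxE; exact: mA. Qed.

Lemma measurable_vnorm n (v : T -> 'cV[R]_n) :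
  mx_measurable v -> measurable_fun setT (fun w => vnorm (v w)).
Proof.
move=> mv; rewrite (_ : (fun w => _) = (fun w => (\sum_j v w j ord0 ^+ 2) `^ 2^-1)).
  apply: (measurableT_comp (measurable_powR _)).
  by apply: measurable_sum => j; apply: measurable_funX; exact: mv.
apply/funext => w; rewrite powR12_sqrt// sumr_ge0// => j _.
exact: sqr_ge0.
Qed.

Lemma measurable_vnorm_powR n (v : T -> 'cV[R]_n) p :
  mx_measurable v -> measurable_fun setT (fun w => (vnorm (v w) `^ p)%:E).
Proof.
move=> mv; apply/measurable_EFinP.
by apply: (measurableT_comp (measurable_powR _)); exact: measurable_vnorm.
Qed.

End measurable_matrix.

(** * Rotations in a coordinate plane *)

Section givens.
Context (R : realType) (n : nat).
Variables (i j : 'I_n) (c s : R).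
Hypothesis ij : i != j.

Definition givens : 'M[R]_n :=
  1%:M + (c - 1) *: delta_mx i i - s *: delta_mx i j
  + s *: delta_mx j i + (c - 1) *: delta_mx j j.

Lemma mul_delta_cV (k l : 'I_n) (v : 'cV[R]_n) q :
  (delta_mx k l *m v) q ord0 = (q == k)%:R * v l ord0.
Proof.
rewrite mxE (bigD1 l)//= mxE eqxx andbT big1 ?addr0// => r rl.
by rewrite mxE (negbTE rl) andbF mul0r.
Qed.

(** The case split is that of [rotfam], so that rotating a family and multiplying by [givens] line
    up. *)
Lemma mul_givens (v : 'cV[R]_n) k : (givens *m v) k ord0 =
  if k == i then c * v i ord0 - s * v j ord0
  else if k == j then s * v i ord0 + c * v j ord0 else v k ord0.
Proof.
rewrite /givens !mulmxDl mulNmx mul1mx -!scalemxAl.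
rewrite [LHS]mxE [X in X + _]mxE [X in X + _ + _]mxE [X in X + _ + _ + _]mxE.
rewrite [X in _ + X + _ + _ + _]mxE [X in _ + _ + X + _ + _]mxE.
rewrite [X in _ - X + _ + _]mxE [X in _ + _ + _ + X + _]mxE.
rewrite [X in _ + _ + _ + _ + X]mxE !mul_delta_cV.
have [->|ki] := eqVneq k i.
  by rewrite (negbTE ij) /=; ring.
by have [->|kj] := eqVneq k j => /=; ring.
Qed.

Hypothesis cs : c ^+ 2 + s ^+ 2 = 1.

Lemma dot_givens (u v : 'cV[R]_n) :
  (givens *m u)^T *m (givens *m v) = u^T *m v.
Proof.
have ji : (j == i) = false by rewrite eq_sym; exact/negbTE.
apply/matrixP => x z; rewrite !ord1 !mxE.
under eq_bigr => k _ do rewrite [_^T _ _]mxE !mul_givens.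
under [RHS]eq_bigr => k _ do rewrite [_^T _ _]mxE.
rewrite (bigD1 i)//= (bigD1 j) ?ji//= [RHS](bigD1 i)//= [X in _ = _ + X](bigD1 j) ?ji//=.
rewrite !eqxx ?ji !addrA; congr (_ + _); last first.
  by apply: eq_bigr => k /andP[/negbTE -> /negbTE ->].
rewrite [LHS](_ : _ = (c ^+ 2 + s ^+ 2) * (u i ord0 * v i ord0) +
  (c ^+ 2 + s ^+ 2) * (u j ord0 * v j ord0)); last by ring.
by rewrite cs !mul1r.
Qed.

Lemma vnorm_givens (v : 'cV[R]_n) : vnorm (givens *m v) = vnorm v.
Proof. by rewrite !vnormE dot_givens. Qed.

End givens.

(** * Moments of one random step *)

Section gaussian_block.
Context (R : realType) (d : measure_display) (T : measurableType d)
  (P : probability T R) (n b : nat) (sigma kappa : R).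
Hypothesis sigma0 : sigma != 0.
Local Notation I := ('I_b * 'I_n)%type.

Definition block_col (f : I -> R) (i : 'I_b) : 'cV[R]_n := \col_j f (i, j).

(** The matrix [M_k] as a function of the scalar coordinates of one block of data, with [kappa] in
    the role of eta/b. *)
Definition sgd_mx (f : I -> R) : 'M[R]_n :=
  1%:M - kappa *: \sum_(i < b) (block_col f i *m (block_col f i)^T).

Lemma sgd_mx_measurable : mx_measurable
  (fun f : g_sigma_algebraType (@cylinders R I) => sgd_mx f).
Proof.
have mc i : mx_measurable
    (fun f : g_sigma_algebraType (@cylinders R I) => block_col f i).
  move=> j k; rewrite [X in measurable_fun _ X](_ : _ = fun f : I -> R => f (i, j)).
    exact: measurable_cyl_coord.
  by apply/funext => f; rewrite mxE.
apply: mx_measurableD; first exact: mx_measurable_cst.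
apply: mx_measurableN; apply: mx_measurableZ; first exact: measurable_cst.
apply: mx_measurable_sum => i; apply: mx_measurableM; first exact: mc.
by apply: mx_measurable_tr; exact: mc.
Qed.

Lemma measurable_block_vnorm (z : 'cV[R]_n) p : measurable_fun setT
  (fun f : g_sigma_algebraType (@cylinders R I) => (vnorm (sgd_mx f *m z) `^ p)%:E).
Proof.
apply: measurable_vnorm_powR; apply: mx_measurableM; first exact: sgd_mx_measurable.
exact: mx_measurable_cst.
Qed.

Definition block_moment (xi : I -> T -> R) (p : R) (z : 'cV[R]_n) : \bar R :=
  (\int[P]_w (vnorm (sgd_mx (xi^~ w) *m z) `^ p)%:E)%E.

Lemma block_moment_gaussian (xi xi' : I -> T -> R) p z :
  gaussian_family P sigma xi -> gaussian_family P sigma xi' ->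
  block_moment xi p z = block_moment xi' p z.
Proof.
move=> [mxi gxi] [mxi' gxi'].
apply: (eq_law_integral (F := fun f => (vnorm (sgd_mx f *m z) `^ p)%:E) mxi mxi').
- by move=> B mB; rewrite gxi// gxi'.
- exact: measurable_block_vnorm.
- by move=> f; rewrite lee_fin powR_ge0.
Qed.

Section rotation.
Variables (i j : 'I_n) (c s : R).
Hypotheses (ij : i != j) (cs : c ^+ 2 + s ^+ 2 = 1) (c1 : c != - 1).

Definition rotblock (xi : I -> T -> R) (k : I) (w : T) : R :=
  (givens i j c s *m block_col (xi^~ w) k.1) k.2 ord0.

(** The vectors of the block are rotated one after another. In [rotP], the list [r] holds those
    already rotated. *)
Lemma gaussian_rotblock xi :
  gaussian_family P sigma xi -> gaussian_family P sigma (rotblock xi).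
Proof.
move=> gxi; pose rot (q : 'I_b) := rotfam (T := T) (q, i) (q, j) c s.
have rotP (r : seq 'I_b) : uniq r ->
    gaussian_family P sigma (foldr rot xi r) /\
    foldr rot xi r = fun k w => if k.1 \in r then rotblock xi k w else xi k w.
  elim: r => [|q r IH] /=; first by [].
  move=> /andP[qr /IH[gr eqr]]; split.
    by apply: gaussian_family_rotfam => //; rewrite xpair_eqE eqxx.
  rewrite eqr.
  apply/funext => -[k1 k2]; apply/funext => w.
  rewrite /rot /rotfam /= !xpair_eqE inE (negbTE qr) /rotblock mul_givens// !mxE.
  by have [->|kq] /= := eqVneq k1 q; rewrite ?(negbTE qr).
have [gr eqr] := rotP (enum 'I_b) (enum_uniq _).
rewrite (_ : rotblock xi = foldr rot xi (enum 'I_b))// eqr.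
by apply/funext => k; apply/funext => w; rewrite mem_enum.
Qed.

(** Rotating all data vectors by the orthogonal [G] keeps their law and replaces [M] by its
    conjugate [M'], with [M' G = G M]. Hence [M' G z = G (M z)] has the norm of [M z]. *)
Lemma block_moment_givens xi p z : gaussian_family P sigma xi ->
  block_moment xi p (givens i j c s *m z) = block_moment xi p z.
Proof.
move=> gxi; rewrite (block_moment_gaussian _ _ gxi (gaussian_rotblock gxi)).
apply: eq_integral => w _; congr (_ `^ _)%:E.
set G := givens i j c s.
rewrite -[RHS](vnorm_givens ij cs) -/G; congr vnorm.
rewrite /sgd_mx !mulmxBl !mul1mx mulmxBr -!scalemxAl -scalemxAr.
congr (_ - _ *: _); rewrite !mulmx_suml mulmx_sumr; apply: eq_bigr => k _.
have -> : block_col (fun l => rotblock xi l w) k = G *m block_col (xi^~ w) k.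
  by apply/colP => l; rewrite mxE.
by rewrite -!mulmxA dot_givens.
Qed.

End rotation.

(** Induction on the number of nonzero coordinates of [z] other than [i0]. A rotation kills one of
    them; once none is left, [z] is a multiple of the basis vector and homogeneity concludes. *)
Lemma block_moment_vnorm xi p z i0 : gaussian_family P sigma xi ->
  block_moment xi p z = ((vnorm z `^ p)%:E * block_moment xi p (delta_mx i0 ord0))%E.
Proof.
move=> gxi.
have [m] := ubnP #|[set l | (l != i0) && (z l ord0 != 0)]|%SET.
elim: m z => // m IH z; rewrite ltnS => zm.
have [z0|] := set_0Vmem [set l | (l != i0) && (z l ord0 != 0)]%SET.
  have zE : z = z i0 ord0 *: delta_mx i0 ord0.
    apply/colP => l; rewrite !mxE eqxx andbT.
    have [->|li0] := eqVneq l i0; first by rewrite mulr1.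
    rewrite mulr0; apply/eqP/negPn/negP => zl.
    by have := finset.in_set0 l; rewrite -z0 inE li0 zl.
  have nz : vnorm z = `|z i0 ord0| by rewrite zE vnormZ vnorm_delta mulr1 !mxE !eqxx mulr1.
  rewrite /block_moment -ge0_integralZl_EFin//; last 3 first.
  - by move=> w _; rewrite lee_fin powR_ge0.
  - case: gxi => mxi _.
    exact: (measurableT_comp (measurable_block_vnorm _ p) (measurable_to_cyl mxi)).
  - exact: powR_ge0.
  apply: eq_integral => w _; rewrite -EFinM nz -powRM ?vnorm_ge0//.
  by rewrite {1}zE -scalemxAr vnormZ.
move=> [l]; rewrite inE => /andP[li0 zl].
pose r := Num.sqrt (z i0 ord0 ^+ 2 + z l ord0 ^+ 2).
have r2 : r ^+ 2 = z i0 ord0 ^+ 2 + z l ord0 ^+ 2.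
  by rewrite sqr_sqrtr// addr_ge0// sqr_ge0.
have r0 : r != 0.
  apply/eqP => r0; have := r2; rewrite r0 expr0n /= => /esym/eqP.
  by rewrite paddr_eq0 ?sqr_ge0// !expf_eq0/= (negbTE zl) andbF.
(* Chosen so that the new coordinate [l], which is [s * z_i0 + c * z_l], vanishes. The excluded case
   [c = - 1] would force [s = 0], contrary to [z_l != 0]. *)
pose c := z i0 ord0 / r; pose s := - z l ord0 / r.
have cs : c ^+ 2 + s ^+ 2 = 1.
  by rewrite /c /s !exprMn sqrrN -mulrDl -r2 -exprMn divff// expr1n.
have c1 : c != - 1.
  apply/eqP => c1; move: cs; rewrite c1 sqrrN expr1n => /eqP.
  rewrite -subr_eq0 addrC addKr expf_eq0/= /s mulf_eq0 oppr_eq0 invr_eq0.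
  by rewrite (negbTE zl) (negbTE r0).
have i0l : i0 != l by rewrite eq_sym.
rewrite -(block_moment_givens i0l cs c1 _ _ gxi) -(vnorm_givens i0l cs z).
apply: IH; apply: leq_trans zm; apply: proper_card; apply/properP; split.
  apply/fintype.subsetP => k; rewrite !inE => /andP[ki0].
  rewrite ki0 mul_givens// (negbTE ki0).
  by have [->|kl //] := eqVneq k l.
exists l; first by rewrite inE li0 zl.
rewrite inE li0 mul_givens// (negbTE li0) eqxx negbK.
by apply/eqP; rewrite /c /s; field.
Qed.

End gaussian_block.

(** * The data process *)

Section events.
Context (R : realType) (dT : measure_display) (Omega : measurableType dT).
Context (n : nat) (v : Omega -> 'cV[R]_n) (u : Omega -> R).
Hypothesis mv : forall j, measurable_fun setT (fun w => v w j ord0).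
Hypothesis mu : measurable_fun setT u.

Lemma vec_events_measurable : vec_events v `<=` measurable.
Proof. by move=> _ [B [mB ->]]; exact: bigcap_preimage_measurable. Qed.

Lemma setI_closed_vec_events : setI_closed (vec_events v).
Proof.
move=> _ _ [B [mB ->]] [C [mC ->]]; exists (fun j => B j `&` C j); split.
  by move=> j; exact: measurableI.
by rewrite -bigcapI; apply: eq_bigcapr => i _; rewrite preimage_setI.
Qed.

Lemma vec_events_setT : vec_events v setT.
Proof. by exists (fun=> setT); split => //; apply/seteqP; split. Qed.

Lemma vec_events_coord j (B : set R) : measurable B ->
  vec_events v ((fun w => v w j ord0) @^-1` B).
Proof.
move=> mB; exists (fun k => if k == j then B else setT); split.
  by move=> k; case: ifP.
apply/seteqP; split => [w Bw k _ /=|w /(_ j Logic.I)/=]; last by rewrite eqxx.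
by case: eqP => // ->.
Qed.

Lemma pair_eventsP A : pair_events v u A <->
  exists2 V, vec_events v V & exists2 C, measurable C & A = V `&` (u @^-1` C).
Proof.
split=> [[B [C [mB [mC ->]]]]|[_ [B [mB ->]] [C mC ->]]]; last by exists B, C.
by exists (\bigcap_(j in [set: 'I_n]) ((fun w => v w j ord0) @^-1` B j)); [exists B|exists C].
Qed.

Lemma pair_events_measurable : pair_events v u `<=` measurable.
Proof.
move=> _ /pair_eventsP[V hV [C mC ->]]; apply: measurableI.
  exact: vec_events_measurable.
by rewrite -[X in measurable X]setTI; exact: mu.
Qed.

Lemma setI_closed_pair_events : setI_closed (pair_events v u).
Proof.
move=> _ _ /pair_eventsP[V hV [C mC ->]] /pair_eventsP[V' hV' [C' mC' ->]].
apply/pair_eventsP; exists (V `&` V'); first exact: setI_closed_vec_events.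
by exists (C `&` C'); [exact: measurableI|rewrite setIACA preimage_setI].
Qed.

Lemma vec_events_pair_events : vec_events v `<=` pair_events v u.
Proof.
move=> V hV; apply/pair_eventsP; exists V => //; exists setT => //.
by rewrite preimage_setT setIT.
Qed.

Lemma pair_events_coord (C : set R) : measurable C -> pair_events v u (u @^-1` C).
Proof.
move=> mC; apply/pair_eventsP; exists setT; first exact: vec_events_setT.
by exists C => //; rewrite setTI.
Qed.

End events.

Section data.
Context (R : realType) (dT : measure_display) (Omega : measurableType dT)
  (P : probability Omega R) (d b : nat) (eta sigma : R)
  (a : nat -> Omega -> 'cV[R]_d) (y : nat -> Omega -> R) (x0 : Omega -> 'cV[R]_d).
Hypothesis ma : forall i (j : 'I_d), measurable_fun setT (fun w => a i w j ord0).
Hypothesis my : forall i, measurable_fun setT (y i).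
Hypothesis mx0 : forall j : 'I_d, measurable_fun setT (fun w => x0 w j ord0).

Definition data_events (o : option nat) : set (set Omega) :=
  match o with
  | None => vec_events x0
  | Some i => pair_events (a i) (y i)
  end.

Hypothesis indep : indep_systems P data_events.
Hypothesis iid : forall i (B : 'I_d -> set R) (C : set R),
  (forall j, measurable (B j)) -> measurable C ->
  P (pair_event (a i) (y i) B C) = P (pair_event (a 0) (y 0) B C).
Hypothesis sigma0 : sigma != 0.
Hypothesis gauss : forall i (B : 'I_d -> set R), (forall j, measurable (B j)) ->
  P (\bigcap_(j in [set: 'I_d]) ((fun w => a i w j ord0) @^-1` B j)) =
  (\prod_(j < d) normal_prob 0 sigma (B j))%E.

Lemma data_events_measurable o : data_events o `<=` measurable.
Proof. by case: o => [i|]; [exact: pair_events_measurable|exact: vec_events_measurable]. Qed.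

Lemma setI_closed_data_events o : setI_closed (data_events o).
Proof. by case: o => [i|]; [exact: setI_closed_pair_events|exact: setI_closed_vec_events]. Qed.

Lemma data_events_setT o : data_events o setT.
Proof.
case: o => [i|]; last exact: vec_events_setT.
by apply: vec_events_pair_events; exact: vec_events_setT.
Qed.

(** Blocks count from 1 and data from 0. By truncated subtraction block 0 repeats block 1, whereas
    the sums in [Hmat] and [qvec] are empty at 0; hence the assumption [1 <= k] below. *)
Definition block_index (k : nat) (i : 'I_b) : nat := (i + b * (k - 1))%N.

Definition block_seq k : seq (option nat) := [seq Some (block_index k i) | i <- enum 'I_b].

Lemma uniq_block_seq k : uniq (block_seq k).
Proof.
by rewrite map_inj_uniq ?enum_uniq// => i j [] /addIn /val_inj.
Qed.

(** The right side is free of [k]: all blocks have the same joint law. *)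
Lemma block_prob k (B : 'I_b -> 'I_d -> set R) (C : 'I_b -> set R) :
  (forall i j, measurable (B i j)) -> (forall i, measurable (C i)) ->
  P (\bigcap_(i in [set: 'I_b])
       pair_event (a (block_index k i)) (y (block_index k i)) (B i) (C i)) =
  (\prod_(i < b) P (pair_event (a 0) (y 0) (B i) (C i)))%E.
Proof.
move=> mB mC.
(* Independence speaks of data indices, so the sets are carried from positions in the block to
   indices, with the whole line as default. *)
pose B' m : 'I_d -> set R := oapp B (fun=> setT) (insub (m - b * (k - 1))%N).
pose C' m : set R := oapp C setT (insub (m - b * (k - 1))%N).
have B'E i : B' (block_index k i) = B i by rewrite /B' /block_index addnK valK.
have C'E i : C' (block_index k i) = C i by rewrite /C' /block_index addnK valK.
pose A (o : option nat) : set Omega :=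
  if o is Some m then pair_event (a m) (y m) (B' m) (C' m) else setT.
have GA o : o \in block_seq k -> data_events o (A o).
  move=> /mapP[i _ ->]; exists (B' (block_index k i)), (C' (block_index k i)).
  split; first by rewrite B'E => j; exact: mB.
  by split; first by rewrite C'E; exact: mC.
have := indep (uniq_block_seq k) GA.
rewrite /block_seq big_map big_enum /=.
rewrite (_ : \bigcap_(o in _) A o = \bigcap_(i in [set: 'I_b])
    pair_event (a (block_index k i)) (y (block_index k i)) (B i) (C i)); last first.
  apply/seteqP; split => [w Aw i _|w Bw _ /mapP[i _ ->]].
    have := Aw (Some (block_index k i)); rewrite /= B'E C'E; apply.
    by apply/mapP; exists i; rewrite ?mem_enum.
  by rewrite /A B'E C'E; exact: Bw.
move=> ->; apply: eq_bigr => i _.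
by rewrite B'E C'E iid//; exact: mB.
Qed.

Definition block_family k (q : 'I_b * 'I_d) (w : Omega) : R :=
  a (block_index k q.1) w q.2 ord0.

Lemma pair_event_setT i (B : 'I_d -> set R) :
  pair_event (a i) (y i) B setT =
  \bigcap_(j in [set: 'I_d]) ((fun w => a i w j ord0) @^-1` B j).
Proof. by rewrite /pair_event preimage_setT setIT. Qed.

Lemma gaussian_block_family k : gaussian_family P sigma (block_family k).
Proof.
split=> [q|B mB]; first exact: ma.
have := @block_prob k (fun i j => B (i, j)) (fun=> setT) (fun i j => mB _)
  (fun=> measurableT).
rewrite (_ : \bigcap_(i in _) pair_event _ _ _ _ =
    \bigcap_(q in [set: 'I_b * 'I_d]) (block_family k q @^-1` B q)); last first.
  apply/seteqP; split => [w Bw [i j] _|w Bw i _].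
    by have := Bw i Logic.I; rewrite pair_event_setT => /(_ j Logic.I).
  by rewrite pair_event_setT => j _; exact: (Bw (i, j) Logic.I).
move=> ->.
under eq_bigr => i _ do rewrite pair_event_setT gauss//.
rewrite pair_big_dep /=; apply: eq_bigr => -[i j] _ //.
Qed.

Lemma Mmat_block k w : (1 <= k)%N ->
  Mmat eta b a k w = sgd_mx (eta / b%:R) (fun q => block_family k q w).
Proof.
move=> k1; rewrite /Mmat /sgd_mx /Hmat; congr (_ - _ *: _).
rewrite -{1}[(b * (k - 1))%N]add0n big_addn -mulnBr subKn// muln1 big_mkord.
apply: eq_bigr => i _; rewrite (_ : block_col _ i = a (block_index k i) w)//.
by apply/colP => j; rewrite mxE.
Qed.

Lemma qvec_block k w : (1 <= k)%N ->
  qvec eta b a y k w = (eta / b%:R) *: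
    \sum_(i < b) (y (block_index k i) w *: a (block_index k i) w).
Proof.
move=> k1; rewrite /qvec; congr (_ *: _).
by rewrite -{1}[(b * (k - 1))%N]add0n big_addn -mulnBr subKn// muln1 big_mkord.
Qed.

(** With [N = b * (k - 1)] this lists everything that [x_(k-1)] and [Pi_(k-1)] depend on. *)
Definition past_seq N : seq (option nat) := None :: [seq Some i | i <- iota 0 N].

Lemma uniq_past_block k : uniq (past_seq (b * (k - 1)) ++ block_seq k).
Proof.
rewrite cat_uniq uniq_block_seq andbT /= map_inj_uniq ?iota_uniq; last by move=> i j [].
rewrite andbT; apply/andP; split; first by apply/mapP => -[].
apply/hasPn => _ /mapP[i _ ->]; rewrite inE/=; apply/mapP => -[j].
by rewrite mem_iota add0n => /andP[_ jk] [/eqP]; rewrite eq_sym; apply/negP;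
  rewrite neq_ltn ltn_addl.
Qed.

Local Notation past N := (g_sigma_algebraType (joint_system data_events (past_seq N))).
Local Notation block k := (g_sigma_algebraType (joint_system data_events (block_seq k))).

(** Measurability for the sigma-algebra of [s] expresses that a quantity depends on the data in [s]
    alone. *)
Lemma mx_measurable_a (s : seq (option nat)) i : Some i \in s ->
  mx_measurable (fun w : g_sigma_algebraType (joint_system data_events s) => a i w).
Proof.
move=> si j k _ B mB; rewrite setTI ord1; apply: sub_sigma_algebra.
apply: (sub_joint_system data_events_setT si).
by apply: vec_events_pair_events; exact: vec_events_coord.
Qed.

Lemma measurable_y (s : seq (option nat)) i : Some i \in s ->
  measurable_fun setT (fun w : g_sigma_algebraType (joint_system data_events s) => y i w).
Proof.
move=> si _ B mB; rewrite setTI; apply: sub_sigma_algebra.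
apply: (sub_joint_system data_events_setT si).
exact: pair_events_coord.
Qed.

Lemma mx_measurable_x0 (s : seq (option nat)) : None \in s ->
  mx_measurable (fun w : g_sigma_algebraType (joint_system data_events s) => x0 w).
Proof.
move=> si j k _ B mB; rewrite setTI ord1; apply: sub_sigma_algebra.
apply: (sub_joint_system data_events_setT si).
exact: vec_events_coord.
Qed.

Lemma mx_measurable_Mmat (s : seq (option nat)) k :
  (forall i, (b * (k - 1) <= i < b * k)%N -> Some i \in s) ->
  mx_measurable (fun w : g_sigma_algebraType (joint_system data_events s) =>
    Mmat eta b a k w).
Proof.
move=> ks; apply: mx_measurableD; first exact: mx_measurable_cst.
apply: mx_measurableN; apply: mx_measurableZ; first exact: measurable_cst.
apply: mx_measurable_sum_nat => i ik; apply: mx_measurableM.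
  by apply: mx_measurable_a; exact: ks.
by apply: mx_measurable_tr; apply: mx_measurable_a; exact: ks.
Qed.

Lemma mx_measurable_qvec (s : seq (option nat)) k :
  (forall i, (b * (k - 1) <= i < b * k)%N -> Some i \in s) ->
  mx_measurable (fun w : g_sigma_algebraType (joint_system data_events s) =>
    qvec eta b a y k w).
Proof.
move=> ks; apply: mx_measurableZ; first exact: measurable_cst.
apply: mx_measurable_sum_nat => i ik; apply: mx_measurableZ.
  by apply: measurable_y; exact: ks.
by apply: mx_measurable_a; exact: ks.
Qed.

Lemma mem_past_seq N k i : (b * k <= N)%N -> (b * (k - 1) <= i < b * k)%N ->
  Some i \in past_seq N.
Proof.
move=> kN /andP[_ ik]; rewrite inE/=; apply/mapP; exists i => //.
by rewrite mem_iota add0n /= (leq_trans ik).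
Qed.

Lemma mx_measurable_xiter N k : (b * k <= N)%N ->
  mx_measurable (fun w : past N => xiter eta b a y x0 k w).
Proof.
elim: k => [_|k IH kN] /=; first exact: mx_measurable_x0.
apply: mx_measurableD; last first.
  by apply: mx_measurable_qvec => i; exact: mem_past_seq.
apply: mx_measurableM; first by apply: mx_measurable_Mmat => i; exact: mem_past_seq.
by apply: IH; apply: leq_trans kN; rewrite leq_mul2l leqnSn orbT.
Qed.

Lemma mx_measurable_Pimat N k : (b * k <= N)%N ->
  mx_measurable (fun w : past N => Pimat eta b a k w).
Proof.
elim: k => [_|k IH kN] /=; first exact: mx_measurable_cst.
apply: mx_measurableM; first by apply: mx_measurable_Mmat => i; exact: mem_past_seq.
by apply: IH; apply: leq_trans kN; rewrite leq_mul2l leqnSn orbT.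
Qed.

Lemma mx_measurable_joint m n (s : seq (option nat)) (A : Omega -> 'M[R]_(m, n)) :
  mx_measurable (fun w : g_sigma_algebraType (joint_system data_events s) => A w) ->
  mx_measurable A.
Proof.
move=> mA i j _ B mB; rewrite setTI.
apply: (@g_sigma_sub _ _ (joint_system data_events s)).
  exact: (joint_system_measurable data_events_measurable).
by have := mA i j measurableT B mB; rewrite setTI.
Qed.

Variable j0 : 'I_d.

(** The quantity [m p], with a basis vector as unit vector. It is extended real because its
    finiteness has yet to be shown. *)
Definition moment (p : R) : \bar R :=
  block_moment P (eta / b%:R) (block_family 1) p (delta_mx j0 ord0).

(** [Z] depends on the past and [M_k] on block [k], so [Z w] can be frozen; the inner integral is
    then a block moment at a fixed vector. *)
Lemma integral_Mmat_vnorm k p (Z : Omega -> 'cV[R]_d) : (1 <= k)%N ->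
  mx_measurable (Z : past (b * (k - 1)) -> 'cV[R]_d) ->
  (\int[P]_w (vnorm (Mmat eta b a k w *m Z w) `^ p)%:E =
   moment p * \int[P]_w (vnorm (Z w) `^ p)%:E)%E.
Proof.
move=> k1 mZ.
pose C1 := joint_system data_events (past_seq (b * (k - 1))).
pose C2 := joint_system data_events (block_seq k).
pose f (z : g_sigma_algebraType C1 * g_sigma_algebraType C2) : \bar R :=
  (vnorm (Mmat eta b a k z.2 *m Z z.1) `^ p)%:E.
have mM : mx_measurable (fun w : g_sigma_algebraType C2 => Mmat eta b a k w).
  apply: mx_measurable_Mmat => l /andP[kl lk].
  have lb : (l - b * (k - 1) < b)%N.
    by rewrite ltn_subLR// -mulnSr subn1 prednK.
  by apply/mapP; exists (Ordinal lb); rewrite ?mem_enum//= /block_index /= subnK.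
have mf : measurable_fun setT f.
  apply: measurable_vnorm_powR; apply: mx_measurableM => i j.
    exact: (measurableT_comp (mM i j) measurable_snd).
  exact: (measurableT_comp (mZ i j) measurable_fst).
have f0 z : (0 <= f z)%E by rewrite lee_fin powR_ge0.
have mC s : joint_system data_events s `<=` measurable.
  exact: (joint_system_measurable data_events_measurable).
have CI s : setI_closed (joint_system data_events s).
  exact: (setI_closed_joint_system setI_closed_data_events).
have CT s : joint_system data_events s setT.
  exact: (joint_system_setT data_events_setT).
have := @ge0_integral_indep R _ _ P C1 C2 (mC _) (mC _) (CI _) (CI _) (CT _) (CT _)
  (indep_joint_system indep (uniq_past_block k)) f mf f0.
rewrite /f /= => ->.
rewrite muleC -ge0_integralZr//; last 3 first.
- by apply: measurable_vnorm_powR; exact: mx_measurable_joint mZ.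
- by move=> w _; rewrite lee_fin powR_ge0.
- by apply: integral_ge0 => w _; rewrite lee_fin powR_ge0.
apply: eq_integral => w _.
under eq_integral do rewrite Mmat_block//.
rewrite -/(block_moment P (eta / b%:R) (block_family k) p (Z w)).
rewrite (block_moment_gaussian _ _ _ (gaussian_block_family k) (gaussian_block_family 1)).
exact: (@block_moment_vnorm R _ Omega P d b sigma (eta / b%:R) sigma0
  (block_family 1) p (Z w) j0 (gaussian_block_family 1)).
Qed.

Lemma integral_Pimat_delta k p j :
  (\int[P]_w (vnorm (Pimat eta b a k w *m delta_mx j ord0) `^ p)%:E = moment p ^+ k)%E.
Proof.
elim: k => [|k IH].
  under eq_integral do rewrite /= mul1mx vnorm_delta powR1.
  rewrite integral_cst//. by rewrite mul1e; exact: probability_setT.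
pose Z w := Pimat eta b a k w *m (delta_mx j ord0 : 'cV[R]_d).
have mZ : mx_measurable (Z : past (b * (k.+1 - 1)) -> 'cV[R]_d).
  apply: mx_measurableM; last exact: mx_measurable_cst.
  by apply: mx_measurable_Pimat; rewrite subn1.
transitivity (\int[P]_w (vnorm (Mmat eta b a k.+1 w *m Z w) `^ p)%:E)%E.
  by apply: eq_integral => w _; rewrite /Z mulmxA.
by rewrite (@integral_Mmat_vnorm k.+1 p Z isT mZ) IH expeS.
Qed.

Lemma integral_qvec k p : (1 <= k)%N ->
  (\int[P]_w (vnorm (qvec eta b a y k w) `^ p)%:E =
   \int[P]_w (vnorm (qvec eta b a y 1 w) `^ p)%:E)%E.
Proof.
move=> k1.
(* All scalars of a block in one family: [None] indexes [y], [Some j] a coordinate of [a]. Then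
   [q_k] is a function [V] of this family, whose law is the same for all blocks. *)
pose J := ('I_b * option 'I_d)%type.
pose xi k (q : J) (w : Omega) : R :=
  if q.2 is Some j then a (block_index k q.1) w j ord0 else y (block_index k q.1) w.
have mxi l q : measurable_fun setT (xi l q).
  by rewrite /xi; case: q => i [j|]; [exact: ma|exact: my].
pose V (f : J -> R) : 'cV[R]_d := (eta / b%:R) *:
  \sum_(i < b) (f (i, None) *: \col_(j < d) f (i, Some j)).
pose F (f : g_sigma_algebraType (@cylinders R J)) : \bar R := (vnorm (V f) `^ p)%:E.
have mF : measurable_fun setT F.
  apply: measurable_vnorm_powR; apply: mx_measurableZ; first exact: measurable_cst.
  apply: mx_measurable_sum => i; apply: mx_measurableZ; first exact: measurable_cyl_coord.
  move=> j l; rewrite [X in measurable_fun _ X](_ : _ = fun f : J -> R => f (i, Some j)).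
    exact: measurable_cyl_coord.
  by apply/funext => f; rewrite mxE.
have VE l w : (1 <= l)%N -> qvec eta b a y l w = V (xi l ^~ w).
  move=> l1; rewrite qvec_block//; congr (_ *: _); apply: eq_bigr => i _.
  by congr (_ *: _); apply/colP => j; rewrite mxE.
have FE l : (1 <= l)%N ->
    (\int[P]_w (vnorm (qvec eta b a y l w) `^ p)%:E = \int[P]_w F (xi l ^~ w))%E.
  by move=> l1; apply: eq_integral => w _; rewrite VE.
apply: (etrans (FE k k1)); apply: (etrans _ (esym (FE 1%N isT))).
apply: (eq_law_integral (mxi k) (mxi 1%N)) => [B mB|//|f]; last by rewrite lee_fin powR_ge0.
have xiE l : \bigcap_(q in [set: J]) (xi l q @^-1` B q) =
    \bigcap_(i in [set: 'I_b]) pair_event (a (block_index l i)) (y (block_index l i))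
      (fun j => B (i, Some j)) (B (i, None)).
  apply/seteqP; split => [w Bw i _|w Bw [i [j|]] _].
  - split; last exact: (Bw (i, None) Logic.I).
    by move=> j _; exact: (Bw (i, Some j) Logic.I).
  - by have [/(_ j Logic.I)] := Bw i Logic.I.
  - by have [] := Bw i Logic.I.
by rewrite !xiE !block_prob.
Qed.

End data.

(** * The tail function and the moment bounds *)

Section real_sequences.
Context (R : realType).

Lemma cvg_powR_invn (C : R) : 0 < C ->
  (fun k : nat => C `^ (k.+1%:R^-1)) @ \oo --> (1 : R).
Proof.
move=> C0.
have -> : (fun k : nat => C `^ (k.+1%:R^-1)) = (fun k => expR (harmonic k * ln C)).
  by apply/funext => k; rewrite /powR gt_eqF.
rewrite -(@expR0 R); apply: continuous_cvg; first exact: continuous_expR.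
by rewrite -(mul0r (ln C)); apply: cvgMr_tmp; exact: cvg_harmonic.
Qed.

Lemma cvg_root_squeeze (u : nat -> \bar R) (m : \bar R) (C : R) : 0 < C -> (0 <= m)%E ->
  (forall k, m ^+ k <= u k)%E -> (forall k, u k <= C%:E * m ^+ k)%E ->
  (fun k : nat => fine (u k) `^ (k%:R^-1)) @ \oo --> fine m.
Proof.
(* If [m] is infinite, so is [u k] for [k >= 1]; [fine] sends both to 0 and the limit is 0. *)
move=> C0; case: m => [r| |]//=; last first.
  move=> _ ulo _; rewrite -cvg_shiftS /=.
  rewrite (_ : (fun k => _) = cst 0); first exact: cvg_cst.
  apply/funext => k; have := ulo k.+1.
  rewrite (_ : (+oo ^+ k.+1)%E = +oo%E); last first.
    by elim: k => [|k IH]; rewrite expeS ?IH ?expe0 ?mule1// mulyy.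
  by rewrite leye_eq => /eqP ->; rewrite /= powR0// invr_eq0 pnatr_eq0.
rewrite lee_fin => r0 ulo uhi.
have ufin k : u k = (fine (u k))%:E.
  rewrite fineK// fin_numE gt_eqF ?lt_eqF//.
    by rewrite (le_lt_trans (uhi k))// -EFin_expe -EFinM ltry.
  by rewrite (lt_le_trans _ (ulo k))// -EFin_expe ltNyr.
have lo k : r ^+ k <= fine (u k) by rewrite -lee_fin -ufin EFin_expe.
have hi k : fine (u k) <= C * r ^+ k by rewrite -lee_fin -ufin EFinM EFin_expe.
have root k : (r ^+ k.+1) `^ (k.+1%:R^-1) = r.
  by rewrite -powR_mulrn// -powRrM divff ?powRr1// pnatr_eq0.
(* The shift drops [k = 0], where the exponent is the default inverse 0. *)
rewrite -cvg_shiftS /=.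
apply: (@squeeze_cvgr _ _ _ _ (cst r) (fun k => C `^ (k.+1%:R^-1) * r)).
- apply: nearW => k; apply/andP; split.
    by rewrite -[leLHS](root k) ler_powRl// ?exprn_ge0// invr_ge0.
  rewrite -[X in _ * X](root k) -powRM ?exprn_ge0// ?(ltW C0)//.
  by rewrite ler_powRl// ?invr_ge0// (le_trans _ (lo _))// exprn_ge0.
- exact: cvg_cst.
- rewrite -[X in _ --> X]mul1r; apply: cvgMr_tmp.
  exact: cvg_powR_invn.
Qed.

(** Iteration sums a geometric series. Since [u] and [Q] may be infinite, distributivity is used
    only between nonnegative terms. *)
Lemma le_geometric_recursion (u : nat -> \bar R) (r c : R) (Q : \bar R) :
  0 <= r < 1 -> 0 <= c -> (0 <= Q)%E -> (forall k, 0 <= u k)%E ->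
  (forall k, u k.+1 <= r%:E * u k + c%:E * Q)%E ->
  forall k, (u k <= (r ^+ k)%:E * u 0%N + ((1 - r ^+ k) / (1 - r) * c)%:E * Q)%E.
Proof.
move=> /andP[r0 r1] c0 Q0 u0 hu; have r1' : 1 - r != 0 by rewrite subr_eq0 gt_eqF.
have S0 k : 0 <= (1 - r ^+ k) / (1 - r).
  by rewrite divr_ge0 ?subr_ge0 ?exprn_ile1// ltW.
elim=> [|k IH].
  by rewrite expr0 subrr mul0r mul0r mul0e adde0 mul1e.
apply: (le_trans (hu k)).
apply: (@le_trans _ _ (r%:E * ((r ^+ k)%:E * u 0%N +
  ((1 - r ^+ k) / (1 - r) * c)%:E * Q) + c%:E * Q)%E).
  by apply: leeD => //; apply: lee_wpmul2l; rewrite ?lee_fin.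
rewrite ge0_muleDr; last 2 first.
- by rewrite mule_ge0// lee_fin exprn_ge0.
- by rewrite mule_ge0// lee_fin mulr_ge0.
rewrite !muleA -!EFinM -exprS -addeA; apply: leeD => //.
have Sc : 0 <= r * ((1 - r ^+ k) / (1 - r) * c).
  exact: mulr_ge0 r0 (mulr_ge0 (S0 k) c0).
rewrite -ge0_muleDl ?lee_fin// -EFinD.
rewrite (_ : r * _ + c = (1 - r ^+ k.+1) / (1 - r) * c)// exprS.
by field.
Qed.

End real_sequences.

Lemma ge0_integral_lincomb (R : realType) d (T : measurableType d)
    (mu : {measure set T -> \bar R}) (f g : T -> \bar R) (L K : R) :
  measurable_fun setT f -> measurable_fun setT g ->
  (forall x, (0 <= f x)%E) -> (forall x, (0 <= g x)%E) -> 0 <= L -> 0 <= K ->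
  (\int[mu]_x (L%:E * f x + K%:E * g x) =
   L%:E * \int[mu]_x f x + K%:E * \int[mu]_x g x)%E.
Proof.
move=> mf mg f0 g0 L0 K0; rewrite ge0_integralD//; last 4 first.
- by move=> x _; rewrite mule_ge0.
- exact: measurable_funeM.
- by move=> x _; rewrite mule_ge0.
- exact: measurable_funeM.
by rewrite ge0_integralZl_EFin// ge0_integralZl_EFin.
Qed.

Section moments.
Context (R : realType) (dT : measure_display) (Omega : measurableType dT)
  (P : probability Omega R) (d b : nat) (eta sigma : R)
  (a : nat -> Omega -> 'cV[R]_d) (y : nat -> Omega -> R) (x0 : Omega -> 'cV[R]_d).
Hypothesis ma : forall i (j : 'I_d), measurable_fun setT (fun w => a i w j ord0).
Hypothesis my : forall i, measurable_fun setT (y i).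
Hypothesis mx0 : forall j : 'I_d, measurable_fun setT (fun w => x0 w j ord0).
Hypothesis indep : indep_systems P (data_events a y x0).
Hypothesis iid : forall i (B : 'I_d -> set R) (C : set R),
  (forall j, measurable (B j)) -> measurable C ->
  P (pair_event (a i) (y i) B C) = P (pair_event (a 0) (y 0) B C).
Hypothesis sigma0 : sigma != 0.
Hypothesis gauss : forall i (B : 'I_d -> set R), (forall j, measurable (B j)) ->
  P (\bigcap_(j in [set: 'I_d]) ((fun w => a i w j ord0) @^-1` B j)) =
  (\prod_(j < d) normal_prob 0 sigma (B j))%E.
Variable j0 : 'I_d.
Local Notation m := (moment P b eta a j0).
Local Notation h := (hfun P eta b a).

Lemma moment_ge0 p : (0 <= m p)%E.
Proof. by apply: integral_ge0 => w _; rewrite lee_fin powR_ge0. Qed.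

Lemma mx_measurable_past M n N (A : Omega -> 'M[R]_(M, n)) :
  mx_measurable (A : g_sigma_algebraType (joint_system (data_events a y x0) (past_seq N))
    -> 'M[R]_(M, n)) -> mx_measurable A.
Proof. exact: (mx_measurable_joint ma my mx0). Qed.

Lemma hfunE s : 0 < s -> h s = fine (m s).
Proof.
move=> s0; have d0 : (0 < d)%N by case: j0 => j; exact: leq_trans.
(* The factor [d ^ s] comes from [powR_sum_le], the factor [d] from adding [d] equal column
   moments. *)
have C0 : 0 < d%:R `^ s * d%:R :> R by rewrite mulr_gt0 ?powR_gt0 ?ltr0n.
have PiE k j :
    (\int[P]_w (vnorm (Pimat eta b a k w *m delta_mx j ord0) `^ s)%:E = m s ^+ k)%E.
  exact: (integral_Pimat_delta b eta ma my mx0 indep iid sigma0 gauss).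
apply/cvg_lim => //; apply: (cvg_root_squeeze C0 (moment_ge0 s)) => k.
  rewrite -(PiE k j0) unlock.
  apply: ge0_le_integral_nomeas => w; first by rewrite lee_fin powR_ge0.
  rewrite lee_fin ler_powRl ?vnorm_ge0 ?(ltW s0)//.
  by rewrite vnorm_mulmx_opnorm// vnorm_delta.
rewrite unlock.
have mPi j : measurable_fun setT
    (fun w => (vnorm (Pimat eta b a k w *m delta_mx j ord0) `^ s)%:E).
  apply: measurable_vnorm_powR; apply: mx_measurableM; last exact: mx_measurable_cst.
  apply: (@mx_measurable_past _ _ (b * k)%N).
  exact: mx_measurable_Pimat.
apply: (@le_trans _ _ (\int[P]_w ((d%:R `^ s)%:E *
    \sum_(j < d) (vnorm (Pimat eta b a k w *m delta_mx j ord0) `^ s)%:E))%E).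
  apply: ge0_le_integral_nomeas => w; first by rewrite lee_fin powR_ge0.
  rewrite sumEFin -EFinM lee_fin.
  apply: (le_trans _ (powR_sum_le s0 (fun j => vnorm_ge0 _))).
  by rewrite ler_powRl ?opnorm_ge0 ?opnorm_le ?(ltW s0).
rewrite ge0_integralZl_EFin ?powR_ge0//; last 2 first.
- by move=> w _; apply: sume_ge0 => j _; rewrite lee_fin powR_ge0.
- exact: emeasurable_sum.
rewrite ge0_integral_sum//; last by move=> j w _; rewrite lee_fin powR_ge0.
under eq_bigr => j _ do rewrite PiE.
rewrite (eq_bigr (fun=> 1%:E * m s ^+ k)%E); last by move=> j _; rewrite mul1e.
by rewrite -ge0_sume_distrl// sumEFin sumr_const card_ord muleA -EFinM.
Qed.


Lemma moment_le1 p s : 0 < p -> p < s -> m s = 1%E -> (m p <= 1)%E.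
Proof.
move=> p0 ps ms; have s0 : 0 < s by exact: lt_trans ps.
have ps0 : 0 <= p / s by rewrite divr_ge0 ?ltW.
have ps1 : 0 <= 1 - p / s by rewrite subr_ge0 ler_pdivrMr// mul1r ltW.
(* Since [Pi_1 = M_1], the moments of [v] are the values of [m]; Young's inequality is integrated
   along [v]. *)
pose v w := vnorm (Pimat eta b a 1 w *m (delta_mx j0 ord0 : 'cV[R]_d)).
have mv q : measurable_fun setT (fun w => (v w `^ q)%:E).
  apply: measurable_vnorm_powR; apply: mx_measurableM; last exact: mx_measurable_cst.
  by apply: (@mx_measurable_past _ _ (b * 1)%N); exact: mx_measurable_Pimat.
have vE q : (\int[P]_w (v w `^ q)%:E = m q)%E.
  exact: (integral_Pimat_delta b eta ma my mx0 indep iid sigma0 gauss j0 1).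
rewrite -vE.
apply: (@le_trans _ _ (\int[P]_w ((p / s)%:E * (v w `^ s)%:E + (1 - p / s)%:E))%E).
  apply: ge0_le_integral_nomeas => w; first by rewrite lee_fin powR_ge0.
  by rewrite -EFinM -EFinD lee_fin powR_young ?vnorm_ge0.
rewrite ge0_integralD//; last 2 first.
- by move=> w _; rewrite mule_ge0 ?lee_fin ?powR_ge0.
- exact: measurable_funeM.
rewrite ge0_integralZl_EFin//; last by move=> w _; rewrite lee_fin powR_ge0.
rewrite vE ms mule1 integral_cst//.
rewrite [X in (_ * X)%E](_ : _ = 1%E); last exact: probability_setT.
by rewrite mule1 -EFinD addrC subrK.
Qed.

Lemma hfun_lt1 p alpha : 0 < p < alpha -> h alpha = 1 ->
  (forall beta, 0 < beta -> h beta = 1 -> beta = alpha) ->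
  m p = (h p)%:E /\ 0 <= h p < 1.
Proof.
move=> /andP[p0 pa] ha uniq_alpha; have a0 : 0 < alpha by exact: lt_trans pa.
(* An infinite moment is ruled out because [fine] would turn it into 0, not 1. *)
have ma1 : m alpha = 1%E.
  move: ha; rewrite hfunE//; have := moment_ge0 alpha.
  case: (m alpha) => [r|_ /=|]//=; first by move=> _ ->.
  by move/eqP; rewrite eq_sym oner_eq0.
have mp1 := moment_le1 p0 pa ma1.
have mpE : m p = (h p)%:E.
  rewrite hfunE// fineK// ge0_fin_numE ?moment_ge0//.
  exact: le_lt_trans mp1 (ltry _).
split => //; rewrite -lee_fin -mpE moment_ge0/= lt_neqAle -lee_fin -mpE mp1 andbT.
by apply/eqP => /(uniq_alpha _ p0) pE; move: pa; rewrite pE ltxx.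
Qed.

(** The constants [L] and [K] are kept abstract to treat both ranges of [p] at once: they are 1 and
    1 under subadditivity, and [1 + eps] with its companion constant under convexity. *)
Lemma expectation_xiter_le p r L K : 0 < p -> 0 <= L -> 0 <= K -> 0 <= L * r < 1 ->
  m p = r%:E ->
  (forall u v : R, 0 <= u -> 0 <= v -> (u + v) `^ p <= L * u `^ p + K * v `^ p) ->
  forall k, ('E_P[fun w => (vnorm (xiter eta b a y x0 k w) `^ p)%R] <=
    ((L * r) ^+ k)%:E * 'E_P[fun w => (vnorm (x0 w) `^ p)%R] +
    ((1 - (L * r) ^+ k) / (1 - L * r) * K)%:E *
      'E_P[fun w => (vnorm (qvec eta b a y 1 w) `^ p)%R])%E.
Proof.
move=> p0 L0 K0 Lr mp conv k; rewrite unlock.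
apply: (@le_geometric_recursion _
  (fun k => \int[P]_w (vnorm (xiter eta b a y x0 k w) `^ p)%:E)%E) => //.
- by apply: integral_ge0 => w _; rewrite lee_fin powR_ge0.
- by move=> l; apply: integral_ge0 => w _; rewrite lee_fin powR_ge0.
move=> {}k.
have mx : mx_measurable (xiter eta b a y x0 k).
  by apply: (@mx_measurable_past _ _ (b * k)%N); exact: mx_measurable_xiter.
have mM : mx_measurable (Mmat eta b a k.+1).
  apply: (@mx_measurable_past _ _ (b * k.+1)%N).
  by apply: mx_measurable_Mmat => i; exact: mem_past_seq.
have mq : mx_measurable (qvec eta b a y k.+1).
  apply: (@mx_measurable_past _ _ (b * k.+1)%N).
  by apply: mx_measurable_qvec => i; exact: mem_past_seq.
pose U w := (vnorm (Mmat eta b a k.+1 w *m xiter eta b a y x0 k w) `^ p)%:E.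
pose V w := (vnorm (qvec eta b a y k.+1 w) `^ p)%:E.
have mU : measurable_fun setT U.
  by apply: measurable_vnorm_powR; exact: mx_measurableM.
have mV : measurable_fun setT V by exact: measurable_vnorm_powR.
have U0 w : (0 <= U w)%E by rewrite lee_fin powR_ge0.
have V0 w : (0 <= V w)%E by rewrite lee_fin powR_ge0.
apply: (@le_trans _ _ (\int[P]_w (L%:E * U w + K%:E * V w))%E).
  apply: ge0_le_integral_nomeas => w; first by rewrite lee_fin powR_ge0.
  rewrite -!EFinM -EFinD lee_fin.
  apply: (le_trans _ (conv _ _ (vnorm_ge0 _) (vnorm_ge0 _))).
  by rewrite ler_powRl ?vnorm_ge0 ?(ltW p0)//=; exact: ler_vnormD.
rewrite (ge0_integral_lincomb P mU mV U0 V0 L0 K0).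
have mxk : mx_measurable (xiter eta b a y x0 k : g_sigma_algebraType
    (joint_system (data_events a y x0) (past_seq (b * (k.+1 - 1)))) -> 'cV[R]_d).
  by apply: mx_measurable_xiter; rewrite subn1.
have UE : (\int[P]_w U w =
    r%:E * \int[P]_w (vnorm (xiter eta b a y x0 k w) `^ p)%:E)%E.
  rewrite -mp.
  exact: (integral_Mmat_vnorm eta ma my mx0 indep iid sigma0 gauss j0 p (ltn0Sn k) mxk).
have VE : (\int[P]_w V w = \int[P]_w (vnorm (qvec eta b a y 1 w) `^ p)%:E)%E.
  exact: (integral_qvec b eta ma my indep iid p (ltn0Sn k)).
by clearbody U V; rewrite UE VE muleA -EFinM.
Qed.

End moments.

Unset Implicit Arguments.
Set Strict Implicit.
Set Printing Implicit Defensive.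

Theorem theorem5 (R : realType) (dT : measure_display)
  (Omega : measurableType dT) (P : probability Omega R)
  (d b : nat) (eta sigma : R)
  (a : nat -> Omega -> 'cV[R]_d) (y : nat -> Omega -> R)
  (x0 : Omega -> 'cV[R]_d) (rho alpha : R) :
  (1 <= d)%N -> (1 <= b)%N -> 0 < eta ->
  (* measurability of the data and of x_0 *)
  (forall i (j : 'I_d), measurable_fun setT (fun w => a i w j ord0)) ->
  (forall i, measurable_fun setT (y i)) ->
  (forall j : 'I_d, measurable_fun setT (fun w => x0 w j ord0)) ->
  (* the pairs (a_i, y_i) and x_0 are mutually independent *)
  indep_systems P (fun o : option nat => match o with
                     | None => vec_events x0
                     | Some i => pair_events (a i) (y i) end) ->
  (* the pairs (a_i, y_i) are identically distributed *)
  (forall i (B : 'I_d -> set R) (C : set R),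
     (forall j, measurable (B j)) -> measurable C ->
     P (pair_event (a i) (y i) B C) = P (pair_event (a 0) (y 0) B C)) ->
  (* (A3): a_i ~ N(0, sigma^2 I_d) *)
  0 < sigma ->
  (forall i (B : 'I_d -> set R), (forall j, measurable (B j)) ->
     P (\bigcap_(j in [set: 'I_d]) ((fun w => a i w j ord0) @^-1` B j)) =
     (\big[*%E/1%E]_(j < d) normal_prob 0 sigma (B j))%E) ->
  (* (A2): y_i has a continuous density supported on R, all moments finite *)
  (exists f : R -> R, continuous f /\ (forall x, 0 <= f x) /\
     closure [set x | f x != 0] = setT /\
     forall i (B : set R), measurable B ->
       P (y i @^-1` B) = (\int[lebesgue_measure]_(x in B) (f x)%:E)%E) ->
  (forall i (n : nat), ('E_P[fun w => (`|y i w| ^+ n)%R] < +oo)%E) ->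
  (* rho < 0: rho is the a.s. limit of (2k)^-1 log lambda_max(Pi_k^T Pi_k) *)
  {ae P, forall w, (fun k : nat => ((2 * k)%:R)^-1 *
      ln (lambda_max ((Pimat eta b a k w)^T *m Pimat eta b a k w)))
      @ \oo --> rho} ->
  rho < 0 ->
  (* alpha is the tail-index: the unique alpha > 0 with h(alpha) = 1 *)
  0 < alpha -> hfun P eta b a alpha = 1 ->
  (forall beta, 0 < beta -> hfun P eta b a beta = 1 -> beta = alpha) ->
  (alpha <= 1 ->
     forall p, 0 < p < alpha ->
       hfun P eta b a p < 1 /\
       forall k : nat, (1 <= k)%N ->
         ('E_P[fun w => (vnorm (xiter eta b a y x0 k w) `^ p)%R] <=
          ((hfun P eta b a p) ^+ k)%:E *
            'E_P[fun w => (vnorm (x0 w) `^ p)%R] +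
          ((1 - (hfun P eta b a p) ^+ k) / (1 - hfun P eta b a p))%:E *
            'E_P[fun w => (vnorm (qvec eta b a y 1 w) `^ p)%R])%E) /\
  (1 < alpha ->
     forall p, 1 < p < alpha ->
       hfun P eta b a p < 1 /\
       forall eps, 0 < eps < (hfun P eta b a p)^-1 - 1 ->
       forall k : nat, (1 <= k)%N ->
         ('E_P[fun w => (vnorm (xiter eta b a y x0 k w) `^ p)%R] <=
          (((1 + eps) * hfun P eta b a p) ^+ k)%:E *
            'E_P[fun w => (vnorm (x0 w) `^ p)%R] +
          ((1 - ((1 + eps) * hfun P eta b a p) ^+ k) /
             (1 - (1 + eps) * hfun P eta b a p) *
           (((1 + eps) `^ (p / (p - 1)) - (1 + eps)) /
              ((1 + eps) `^ ((p - 1)^-1) - 1) `^ p))%:E *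
            'E_P[fun w => (vnorm (qvec eta b a y 1 w) `^ p)%R])%E).
Proof.
move=> d1 b1 eta0 ma my mx0 indep iid sigma_gt0 gauss _ _ _ _ alpha0 halpha uniq_alpha.
have sigma0 : sigma != 0 by rewrite gt_eqF.
have Gindep : indep_systems P (data_events a y x0) by [].
pose j0 : 'I_d := Ordinal d1.
have lt1 p : 0 < p < alpha -> moment P b eta a j0 p = (hfun P eta b a p)%:E /\
    0 <= hfun P eta b a p < 1.
  move=> p0a.
  exact: (hfun_lt1 ma my mx0 Gindep iid sigma0 gauss j0 p0a halpha uniq_alpha).
split=> [alpha1 p /andP[p0 pa]|alpha1 p /andP[p1 pa]].
  have [mp /andP[h0 h1]] := lt1 p (introT andP (conj p0 pa)).
  split=> // k _.
  have := expectation_xiter_le ma my mx0 Gindep iid sigma0 gauss (j0 := j0) p0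
    ler01 ler01 _ mp _ k.
  rewrite mul1r mulr1; apply; first by rewrite h0.
  move=> u v u0 v0; rewrite !mul1r powRD_le// p0/=.
  by rewrite ltW// (lt_le_trans pa).
have p0 : 0 < p by exact: lt_trans p1.
have [mp /andP[h0 h1]] := lt1 p (introT andP (conj p0 pa)).
split=> // eps /andP[eps0 epsh] k _.
(* If [h p] were 0, its inverse would be 0 by convention and the range of [eps] would be empty. *)
have hp : 0 < hfun P eta b a p.
  rewrite lt0r h0 andbT; apply/eqP => hp0; move: epsh.
  by rewrite hp0 invr0 sub0r ltNge (le_trans _ (ltW eps0))// oppr_le0.
have e1 : 0 < 1 + eps by rewrite addr_gt0.
apply: (expectation_xiter_le ma my mx0 Gindep iid sigma0 gauss (j0 := j0) p0) => //.
- exact: ltW.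
(* The numerator is nonnegative because [1 + eps] is at least 1 and [p / (p - 1)] is at least 1. *)
- rewrite divr_ge0 ?powR_ge0// subr_ge0 le1r_powR ?lerDl ?(ltW eps0)//.
  by rewrite ler_pdivlMr ?subr_gt0// mul1r gerBl.
- rewrite mulr_ge0 ?(ltW e1)//= -ltr_pdivlMr// mul1r addrC -ltrBrDr.
  exact: epsh.
- by move=> u v u0 v0; exact: powRD_le_eps.
Qed.
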